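(* (i) Let $(P,\rhd,\lhd,\beta_\rhd,\beta_\lhd)$ be a Zinbiel-dendriform bialgebra and $(Q=\bigoplus_{i\in\mathbb Z}Q_i,\circ,\varpi)$ a quadratic $\mathbb Z$-graded Leibniz algebra. Let $\vartheta_\varpi:Q\to Q\hat\otimes Q$ be the linear map determined by $\hat\varpi(\vartheta_\varpi(b_1),b_2\otimes b_3)=-\varpi(b_1,b_2\circ b_3)$ for all $b_1,b_2,b_3\in Q$. Define a binary operation $\cdot$ on $P\otimes Q$ and a linear map $\delta:P\otimes Q\to(P\otimes Q)\hat\otimes(P\otimes Q)$ by $$(a\otimes x)\cdot(b\otimes y)=(a\rhd b)\otimes (x\circ y)-(b\lhd a)\otimes (y\circ x),\qquad \delta(a\otimes x)=\beta_\rhd(a)\bullet\vartheta_\varpi(x)-\tau\beta_\lhd(a)\bullet\hat\tau\vartheta_\varpi(x).$$ Then $(P\otimes Q,\cdot,\delta)$ is a completed pre-Lie bialgebra. (ii) Moreover, let $P$ be a vector space with bilinear operations $\rhd,\lhd$ and linear maps $\beta_\rhd,\beta_\lhd:P\to P\otimes P$, and let $(Q,\circ,\varpi)$ be the following quadratic $\mathbb Z$-graded Leibniz algebra: $Q=W\otimes\mathbb K[t,t^{-1}]=\bigoplus_{n\in\mathbb Z}W\otimes t^n$, $(x\otimes t^m)\circ(y\otimes t^n)=(x\circ y)\otimes t^{m+n}$, $\varpi(x\otimes t^m,y\otimes t^n)=\nu(x,y)\delta_{m+n,0}$, where $W$ has basis $\varepsilon_1,\varepsilon_2,\varepsilon_3,\varepsilon_4$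 with nonzero products $\varepsilon_2\circ\varepsilon_1=\varepsilon_1$, $\varepsilon_2\circ\varepsilon_2=\varepsilon_1$, $\varepsilon_2\circ\varepsilon_3=-\varepsilon_3-\varepsilon_4$, $\varepsilon_3\circ\varepsilon_1=\varepsilon_4$, $\varepsilon_3\circ\varepsilon_2=\varepsilon_3+2\varepsilon_4$, and $\nu$ is the skew-symmetric form with $\nu(\varepsilon_1,\varepsilon_3)=\nu(\varepsilon_2,\varepsilon_4)=1$ and all other $\nu(\varepsilon_i,\varepsilon_j)$, $i<j$, zero. Then $(P\otimes Q,\cdot,\delta)$, with $\cdot$ and $\delta$ given by the same formulas, is a completed pre-Lie bialgebra if and only if $(P,\rhd,\lhd,\beta_\rhd,\beta_\lhd)$ is a Zinbiel-dendriform bialgebra.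
   Context: All vector spaces are over a field $\mathbb K$; $\tau$ is the flip, $I$ the identity. Algebras are finite-dimensional except $\mathbb Z$-graded ones. $L_\ast(a)b=a\ast b$, $R_\ast(a)b=b\ast a$. Completed tensor products: for $\mathbb Z$-graded $U=\bigoplus U_i$, $V=\bigoplus V_j$, $U\hat\otimes V:=\prod_{i,j}U_i\otimes V_j$ (similarly for three factors); elements are formal sums; linear maps and the flip ($\hat\tau$) are extended termwise, composites being understood to be well defined. $P$ is in degree $0$, $P\otimes Q=\bigoplus_iP\otimes Q_i$. $(a_1\otimes a_2)\bullet(x_1\otimes x_2)=(a_1\otimes x_1)\otimes(a_2\otimes x_2)$, extended linearly to formal sums. Zinbiel-dendriform algebra: bilinear $\rhd,\lhd$ such that, with $x\ast y=x\rhd y+x\lhd y$: $x\rhd(y\rhd z)=(x\ast y+y\ast x)\rhd z$ and $x\rhd(z\lhd y)=z\lhd(x\ast y)=(x\rhd z)\lhd y+(z\lhd x)\lhd y$. Zinbiel-dendriform coalgebra: linear $\beta_\rhd,\beta_\lhd:P\to P\otimes P$ with $(I\otimes\beta_\rhd)\beta_\rhd=(\tau\otimes I)(I\otimes\beta_\rhd)\beta_\rhd=((\beta_\rhd+\tau\beta_\rhd+\beta_\lhd+\tau\beta_\lhd)\otimes I)\beta_\rhd$ and $(I\otimes(\beta_\rhd+\beta_\lhd))\beta_\lhd=(\beta_\lhd\otimes I)\beta_\lhd+(\tau\otimes I)(\beta_\rhd\otimes I)\beta_\lhd=(\tau\otimes I)(I\otimes\beta_\lhd)\beta_\rhd$.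 Zinbiel-dendriform bialgebra: a Zinbiel-dendriform algebra and coalgebra on $P$ such that for all $x,y\in P$, with $x\ominus y=x\rhd y+y\lhd x$ (so $L_\ominus=L_\rhd+R_\lhd$, $R_\ominus=L_\lhd+R_\rhd$), $\beta=\beta_\lhd+\beta_\rhd$, $\beta_\ominus=\tau\beta_\lhd+\beta_\rhd$: (1) $\beta_\lhd(x\ast y+y\ast x)=(L_\ast(y)\otimes I)\beta_\lhd(x)+(I\otimes L_\ominus(x))\beta_\lhd(y)$; (2) $\beta(x\ominus y)=(L_\rhd(x)\otimes I)\beta(y)+(I\otimes R_\ominus(y))\beta_\rhd(x)=(I\otimes L_\ominus(x))\beta(y)+(L_\lhd(y)\otimes I)\beta_\lhd(x)$; (3) $\beta_\ominus(x\ast y)=(L_\rhd(x)\otimes I)\beta_\ominus(y)+(I\otimes R_\ast(y))\beta_\rhd(x)$; (4) $(L_\lhd(y)\otimes I)\tau\beta_\ominus(x)+(I\otimes R_\lhd(x))\beta(y)=(\beta+\tau\beta)(y\lhd x)$; (5) $(I\otimes L_\ast(x)-L_\rhd(x)\otimes I)\beta_\ominus(y)=(I\otimes R_\ast(y))\beta_\rhd(x)-(R_\lhd(y)\otimes I)\tau\beta_\lhd(x)$. Quadratic $\mathbb Z$-graded Leibniz algebra $(Q=\bigoplus Q_i,\circ,\varpi)$: each $Q_i$ is finite-dimensional, $Q_i\circ Q_j\subseteq Q_{i+j}$, $x\circ(y\circ z)=(x\circ y)\circ z+y\circ(x\circ z)$, and $\varpi$ is a non-degenerate skew-symmetric bilinear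 form, invariant ($\varpi(x\circ y,z)=\varpi(x,y\circ z+z\circ y)$) and graded (there is $m\in\mathbb Z$ with $\varpi(Q_i,Q_j)=0$ whenever $i+j+m\ne0$). $\hat\varpi(\sum x_{1,i,\alpha}\otimes x_{2,j,\alpha},y_1\otimes y_2)=\sum\varpi(x_{1,i,\alpha},y_1)\varpi(x_{2,j,\alpha},y_2)$. Pre-Lie algebra: $(x\cdot y)\cdot z-x\cdot(y\cdot z)=(y\cdot x)\cdot z-y\cdot(x\cdot z)$. Completed pre-Lie coalgebra $(L,\delta)$: $L=\bigoplus L_i$, $\delta:L\to L\hat\otimes L$ linear with $(I\hat\otimes\delta)\delta-(\hat\tau\hat\otimes I)(I\hat\otimes\delta)\delta=(\delta\hat\otimes I)\delta-(\hat\tau\hat\otimes I)(\delta\hat\otimes I)\delta$. Completed pre-Lie bialgebra $(L,\cdot,\delta)$: $(L,\cdot)$ pre-Lie algebra, $(L,\delta)$ completed pre-Lie coalgebra, and for all $a,b\in L$: $(\delta-\hat\tau\delta)(a\cdot b)-(L_\cdot(a)\hat\otimes I)(\delta-\hat\tau\delta)(b)-(I\hat\otimes L_\cdot(a))(\delta-\hat\tau\delta)(b)-(I\hat\otimes R_\cdot(b))\delta(a)+(R_\cdot(b)\hat\otimes I)\hat\tau\delta(a)=0$; $\delta(a\cdot b-b\cdot a)-(I\hat\otimes(R_\cdot(b)-L_\cdot(b)))\delta(a)-(I\hat\otimes(L_\cdot(a)-R_\cdot(a)))\delta(b)-(L_\cdot(a)\hat\otimes I)\delta(b)+(L_\cdot(b)\hat\otimes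 I)\delta(a)=0$. *)

(* Defs.v *)
From HB Require Import structures.
From mathcomp Require Import all_boot all_order all_algebra.
From mathcomp Require Import boolp classical_sets functions cardinality fsbigop.

Set Implicit Arguments.
Unset Strict Implicit.
Unset Printing Implicit Defensive.

Import GRing.Theory.
Local Open Scope ring_scope.

Reserved Notation "u \ox v" (at level 40, left associativity).

(* U (x) V is the space of coordinate matrices with respect to the library's
   bases of U and V; tlift_pure and tlift_unique below are its universal
   property, and nothing in the statement depends on the bases. *)

Definition tens (K : fieldType) (U V : vectType K) : vectType K :=
  'M[K]_(\dim {:U}, \dim {:V}).

Definition pure (K : fieldType) (U V : vectType K) (u : U) (v : V) :
    tens U V :=
  \matrix_(i, j) (coord (vbasis {:U}) i u * coord (vbasis {:V}) j v).

Notation "u \ox v" := (pure u v) : ring_scope.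

Definition tlift (K : fieldType) (U V : vectType K) (X : lmodType K)
    (f : U -> V -> X) (t : tens U V) : X :=
  \sum_i \sum_j (t : 'M[K]__) i j *: f (vbasis {:U})`_i (vbasis {:V})`_j.

Definition is_bilinear (K : fieldType) (U V X : lmodType K)
    (f : U -> V -> X) : Prop := bilinear_for *:%R *:%R f.

Lemma pure_bilinear (K : fieldType) (U V : vectType K) :
  is_bilinear (@pure K U V).
Proof.
split=> [v | u] a x y; apply/matrixP=> i j.
  by rewrite !mxE linearP /= mulrDl mulrA.
by rewrite !mxE linearP /= mulrDr mulrCA.
Qed.

Lemma tlift_pure (K : fieldType) (U V : vectType K) (X : lmodType K)
    (f : U -> V -> X) (u : U) (v : V) :
  is_bilinear f -> tlift f (u \ox v) = f u v.
Proof.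
move=> [fl fr].
pose gl w := GRing.isLinear.Build K U X *:%R (f^~ w) (fl w).
pose gr w := GRing.isLinear.Build K V X *:%R (f w) (fr w).
have fsumr w I (r : seq I) (c : I -> K) (e : I -> V) :
    f w (\sum_(i <- r) c i *: e i) = \sum_(i <- r) c i *: f w (e i).
  pose h : {linear V -> X} := HB.pack (f w) (gr w).
  by rewrite -[f w]/(h : V -> X) linear_sum; apply: eq_bigr=> i _; rewrite linearZ.
have fsuml w I (r : seq I) (c : I -> K) (e : I -> U) :
    f (\sum_(i <- r) c i *: e i) w = \sum_(i <- r) c i *: f (e i) w.
  pose h : {linear U -> X} := HB.pack (f^~ w) (gl w).
  rewrite -[LHS]/(h _) linear_sum; apply: eq_bigr=> i _.
  by rewrite linearZ.
rewrite [in RHS](coord_vbasis (memvf u)) [in RHS](coord_vbasis (memvf v)).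
rewrite fsuml; apply: eq_bigr=> i _; rewrite fsumr scaler_sumr.
by apply: eq_bigr=> j _; rewrite mxE scalerA.
Qed.

Lemma tlift_unique (K : fieldType) (U V : vectType K) (X : lmodType K)
    (h : tens U V -> X) (t : tens U V) :
  linear h -> tlift (fun u v => h (u \ox v)) t = h t.
Proof.
move=> hlin; pose h' : {linear tens U V -> X} :=
  HB.pack h (GRing.isLinear.Build K (tens U V) X *:%R h hlin).
rewrite -[h]/(h' : tens U V -> X).
rewrite [in RHS](matrix_sum_delta (t : 'M[K]__)) linear_sum.
apply: eq_bigr=> i _; rewrite linear_sum; apply: eq_bigr=> j _.
rewrite linearZ /=; congr (_ *: h _); apply/matrixP=> k l; rewrite !mxE.
have bU := basis_free (vbasisP {:U}); have bV := basis_free (vbasisP {:V}).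
by rewrite !coord_free // -natrM mulnb (eq_sym i) (eq_sym j).
Qed.

Section TensorMaps.
Variable K : fieldType.

Definition tflip (U V : vectType K) : tens U V -> tens V U :=
  tlift (fun u v => v \ox u).

Definition tmap (U V U' V' : vectType K) (f : U -> U') (g : V -> V') :
    tens U V -> tens U' V' :=
  tlift (fun u v => f u \ox g v).

(* The vector u (x) t of U (x) (V (x) W), rebracketed to the left: threefold
   products are (U (x) V) (x) W throughout. *)
Definition tcons (U V W : vectType K) (u : U) :
    tens V W -> tens (tens U V) W :=
  tlift (fun v w => u \ox v \ox w).

End TensorMaps.

Section ZinbielDendriform.
Variables (K : fieldType) (P : vectType K).
Variables (rhd lhd : P -> P -> P) (brhd blhd : P -> tens P P).

Local Notation ast := (fun x y => rhd x y + lhd x y).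
Local Notation ominus := (fun x y => rhd x y + lhd y x).
Local Notation beta := (fun x => blhd x + brhd x).
Local Notation bominus := (fun x => tflip (blhd x) + brhd x).
(* (f (x) I) t and (I (x) f) t *)
Local Notation onl f t := (tmap f (@id P) t).
Local Notation onr f t := (tmap (@id P) f t).

Record zinbiel_dendriform_algebra : Prop := {
  zda_rhd_bilinear : is_bilinear rhd;
  zda_lhd_bilinear : is_bilinear lhd;
  zda_rhd_rhd x y z : rhd x (rhd y z) = rhd (ast x y + ast y x) z;
  zda_rhd_lhd x y z : rhd x (lhd z y) = lhd z (ast x y);
  zda_lhd_ast x y z : lhd z (ast x y) = lhd (rhd x z) y + lhd (lhd z x) y }.

(* (I (x) b) t, (b (x) I) t and (tau (x) I) t *)
Local Notation cor b t := (tlift (fun u v => tcons u (b v)) t).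
Local Notation col b t := (tmap b (@id P) t).
Local Notation tau12 t := (tmap (@tflip K P P) (@id P) t).

Record zinbiel_dendriform_coalgebra : Prop := {
  zdc_brhd_linear : linear brhd;
  zdc_blhd_linear : linear blhd;
  zdc_brhd_flip x : cor brhd (brhd x) = tau12 (cor brhd (brhd x));
  zdc_brhd_brhd x :
    cor brhd (brhd x)
    = col (fun u => brhd u + tflip (brhd u) + blhd u + tflip (blhd u))
          (brhd x);
  zdc_blhd_beta x :
    cor (fun v => brhd v + blhd v) (blhd x)
    = col blhd (blhd x) + tau12 (col brhd (blhd x));
  zdc_blhd_brhd x :
    cor (fun v => brhd v + blhd v) (blhd x) = tau12 (cor blhd (brhd x)) }.

Record zinbiel_dendriform_bialgebra : Prop := {
  zdb_algebra : zinbiel_dendriform_algebra;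
  zdb_coalgebra : zinbiel_dendriform_coalgebra;
  zdb_1 x y :
    blhd (ast x y + ast y x)
    = onl (ast y) (blhd x) + onr (ominus x) (blhd y);
  zdb_2l x y :
    beta (ominus x y)
    = onl (rhd x) (beta y) + onr (ominus^~ y) (brhd x);
  zdb_2r x y :
    beta (ominus x y)
    = onr (ominus x) (beta y) + onl (lhd y) (blhd x);
  zdb_3 x y :
    bominus (ast x y)
    = onl (rhd x) (bominus y) + onr (ast^~ y) (brhd x);
  zdb_4 x y :
    onl (lhd y) (tflip (bominus x)) + onr (lhd^~ x) (beta y)
    = beta (lhd y x) + tflip (beta (lhd y x));
  zdb_5 x y :
    onr (ast x) (bominus y) - onl (rhd x) (bominus y)
    = onr (ast^~ y) (brhd x) - onl (lhd^~ y) (tflip (blhd x)) }.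

End ZinbielDendriform.

Definition famprod (K : fieldType) (S : Type) (X : S -> vectType K) : Type :=
  forall s, X s.

Section DirectProduct.
Variables (K : fieldType) (S : Type) (X : S -> vectType K).

HB.instance Definition _ := gen_eqMixin (famprod X).
HB.instance Definition _ := gen_choiceMixin (famprod X).

Let zero : famprod X := fun=> 0.
Let add (f g : famprod X) : famprod X := fun s => f s + g s.
Let opp (f : famprod X) : famprod X := fun s => - f s.
Let scale (a : K) (f : famprod X) : famprod X := fun s => a *: f s.

Let addA : associative add.
Proof. by move=> f g h; apply: functional_extensionality_dep=> s; apply: addrA. Qed.
Let addC : commutative add.
Proof. by move=> f g; apply: functional_extensionality_dep=> s; apply: addrC. Qed.
Let add0 : left_id zero add.
Proof. by move=> f; apply: functional_extensionality_dep=> s; apply: add0r. Qed.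
Let addN : left_inverse zero opp add.
Proof. by move=> f; apply: functional_extensionality_dep=> s; apply: addNr. Qed.

HB.instance Definition _ := GRing.isZmodule.Build (famprod X) addA addC add0 addN.

Let scaleA a b f : scale a (scale b f) = scale (a * b) f.
Proof. by apply: functional_extensionality_dep=> s; apply: scalerA. Qed.
Let scale1 : left_id 1 scale.
Proof. by move=> f; apply: functional_extensionality_dep=> s; apply: scale1r. Qed.
Let scaleDr : right_distributive scale +%R.
Proof. by move=> a f g; apply: functional_extensionality_dep=> s; apply: scalerDr. Qed.
Let scaleDl f : {morph scale^~ f : a b / a + b}.
Proof. by move=> a b; apply: functional_extensionality_dep=> s; apply: scalerDl. Qed.

HB.instance Definition _ :=
  GRing.Zmodule_isLmodule.Build K (famprod X) scaleA scale1 scaleDr scaleDl.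

End DirectProduct.

(* A Z-graded space with finite-dimensional pieces is given by its pieces. *)
Definition grading (K : fieldType) := int -> vectType K.

Section DirectSum.
Variables (K : fieldType) (U : grading K).

Definition fsupp : {pred famprod U} :=
  fun f => `[< finite_set [set i | f i != 0]%classic >].

Fact fsupp_submod : submod_closed fsupp.
Proof.
split=> [|a f g].
  apply/asboolP; rewrite [X in finite_set X](_ : _ = set0) //.
  by apply/seteqP; split=> // i /=; rewrite eqxx.
move=> /asboolP ff /asboolP fg; apply/asboolP.
apply: (@sub_finite_set _ _ ([set i | f i != 0] `|` [set i | g i != 0])%classic); last first.
  by rewrite finite_setU.
move=> i /= fgi; have [f0|] := eqVneq (f i) 0; last by left.
right; apply: contraNneq fgi => g0.
by change (a *: f i + g i == 0); rewrite f0 g0 scaler0 addr0.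
Qed.

HB.instance Definition _ :=
  GRing.isSubmodClosed.Build K (famprod U) fsupp fsupp_submod.

Record dsum : Type := DSum { dsum_fun : famprod U; _ : dsum_fun \in fsupp }.

Definition component (x : dsum) (i : int) : U i := dsum_fun x i.
Coercion component : dsum >-> Funclass.

HB.instance Definition _ := [isSub for dsum_fun].
HB.instance Definition _ := [Choice of dsum by <:].
HB.instance Definition _ := [SubChoice_isSubLmodule of dsum by <:].

Fact dinj_fsupp (i : int) (x : U i) :
  (dfwith (fun k => 0 : U k) x : famprod U) \in fsupp.
Proof.
apply/asboolP; apply: (@sub_finite_set _ _ [set i]%classic); last exact: finite_set1.
move=> k /= ; have [-> //|ki] := eqVneq k i.
by rewrite dfwith_out ?eqxx // eq_sym.
Qed.

(* The homogeneous element x of U_i, seen in the direct sum. *)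
Definition dinj (i : int) (x : U i) : dsum := DSum (dinj_fsupp x).

End DirectSum.

Section Completed.
Variable K : fieldType.

Definition ctens (U V : grading K) : lmodType K :=
  famprod (fun s : int * int => tens (U s.1) (V s.2)).

Definition ctens3 (U V W : grading K) : lmodType K :=
  famprod (fun s : int * int * int => tens (tens (U s.1.1) (V s.1.2)) (W s.2)).

Definition cflip (U V : grading K) (t : ctens U V) : ctens V U :=
  fun s => tflip (t (s.2, s.1)).

Definition cflip12 (U V W : grading K) (t : ctens3 U V W) : ctens3 V U W :=
  fun s => tmap (@tflip K (U s.1.2) (V s.1.1)) id (t (s.1.2, s.1.1, s.2)).

Section TermwiseExtension.
Variables (U V : grading K) (S : Type) (X : S -> vectType K).
Variable f : dsum U -> dsum V -> famprod X.

(* The contribution of the (i, j) part of a formal sum t in U (x)^ V to the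
   component of index s of the image of t under u (x) v |-> f u v. *)
Definition cterm (t : ctens U V) (s : S) (ij : int * int) : X s :=
  tlift (fun u v => f (dinj u) (dinj v) s) (t ij).

(* The image of t is well defined when each of its components is a finite
   sum; outside this case cext is a junk value. *)
Definition cext_defined (t : ctens U V) : Prop :=
  forall s, finite_set [set ij | cterm t s ij != 0]%classic.

Definition cext (t : ctens U V) : famprod X :=
  fun s => \sum_(ij \in [set: int * int]%classic) cterm t s ij.

End TermwiseExtension.

(* u (x) v |-> f u (x) g v, whose extension cmap f g is f (x)^ g. *)
Definition tens_fun (U V U' V' : grading K) (f : dsum U -> dsum U')
    (g : dsum V -> dsum V') (u : dsum U) (v : dsum V) : ctens U' V' :=
  fun s => f u s.1 \ox g v s.2.

Definition cmap (U V U' V' : grading K) (f : dsum U -> dsum U')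
    (g : dsum V -> dsum V') : ctens U V -> ctens U' V' :=
  cext (tens_fun f g).

Definition cmap_defined (U V U' V' : grading K) (f : dsum U -> dsum U')
    (g : dsum V -> dsum V') : ctens U V -> Prop :=
  cext_defined (tens_fun f g).

End Completed.

Record pre_lie_algebra (K : fieldType) (A : lmodType K) (dot : A -> A -> A) :
    Prop := {
  pla_bilinear : is_bilinear dot;
  pla_assoc x y z :
    dot (dot x y) z - dot x (dot y z) = dot (dot y x) z - dot y (dot x z) }.

Section CompletedPreLie.
Variables (K : fieldType) (L : grading K).
Variables (dot : dsum L -> dsum L -> dsum L) (delta : dsum L -> ctens L L).

(* u (x) v |-> u (x) delta v and u (x) v |-> delta u (x) v *)
Definition id_delta (u v : dsum L) : ctens3 L L L :=
  fun s => tcons (u s.1.1) (delta v (s.1.2, s.2)).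
Definition delta_id (u v : dsum L) : ctens3 L L L :=
  fun s => delta u s.1 \ox v s.2.

Record completed_pre_lie_coalgebra : Prop := {
  cplc_linear : linear delta;
  cplc_id_delta_defined a : cext_defined id_delta (delta a);
  cplc_delta_id_defined a : cext_defined delta_id (delta a);
  cplc_coassoc a :
    cext id_delta (delta a) - cflip12 (cext id_delta (delta a))
    = cext delta_id (delta a) - cflip12 (cext delta_id (delta a)) }.

Local Notation cobr := (fun a => delta a - cflip (delta a)).
(* (f (x)^ I) t and (I (x)^ f) t *)
Local Notation onl f t := (cmap f (@id (dsum L)) t).
Local Notation onr f t := (cmap (@id (dsum L)) f t).
Local Notation onl_defined f t := (cmap_defined f (@id (dsum L)) t).
Local Notation onr_defined f t := (cmap_defined (@id (dsum L)) f t).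

(* The four cplb_*_defined conditions are the well-definedness of all the
   composites below, the remaining ones being differences and flips of these. *)
Record completed_pre_lie_bialgebra : Prop := {
  cplb_algebra : pre_lie_algebra dot;
  cplb_coalgebra : completed_pre_lie_coalgebra;
  cplb_Ll_defined a b : onl_defined (dot a) (delta b);
  cplb_Lr_defined a b : onr_defined (dot a) (delta b);
  cplb_Rl_defined a b : onl_defined (dot^~ a) (delta b);
  cplb_Rr_defined a b : onr_defined (dot^~ a) (delta b);
  cplb_1 a b :
    cobr (dot a b) - onl (dot a) (cobr b) - onr (dot a) (cobr b)
    - onr (dot^~ b) (delta a) + onl (dot^~ b) (cflip (delta a)) = 0;
  cplb_2 a b :
    delta (dot a b - dot b a)
    - onr (fun u => dot u b - dot b u) (delta a)
    - onr (fun u => dot a u - dot u a) (delta b)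
    - onl (dot a) (delta b) + onl (dot b) (delta a) = 0 }.

End CompletedPreLie.

Section QuadraticLeibniz.
Variables (K : fieldType) (Q : grading K).
Variables (circ : dsum Q -> dsum Q -> dsum Q).
Variables (varpi : dsum Q -> dsum Q -> K^o).

Record quadratic_graded_leibniz : Prop := {
  qgl_bilinear : is_bilinear circ;
  qgl_graded (i j : int) (x : Q i) (y : Q j) :
    exists z : Q (i + j), circ (dinj x) (dinj y) = dinj z;
  qgl_leibniz x y z : circ x (circ y z) = circ (circ x y) z + circ y (circ x z);
  qgl_form_bilinear : is_bilinear varpi;
  qgl_form_nondegenerate x : (forall y, varpi x y = 0) -> x = 0;
  qgl_form_skew x y : varpi x y = - varpi y x;
  qgl_form_invariant x y z : varpi (circ x y) z = varpi x (circ y z + circ z y);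
  qgl_form_graded :
    exists m : int, forall (i j : int) (x : Q i) (y : Q j),
      i + j + m != 0 -> varpi (dinj x) (dinj y) = 0 }.

(* The sum is finite when varpi is graded. *)
Definition varpi_hat (t : ctens Q Q) (y1 y2 : dsum Q) : K :=
  \sum_(ij \in [set: int * int]%classic)
    tlift (fun x1 x2 => varpi (dinj x1) y1 * varpi (dinj x2) y2 : K^o) (t ij).

Definition is_vartheta (theta : dsum Q -> ctens Q Q) : Prop :=
  linear theta /\
  forall b1 b2 b3, varpi_hat (theta b1) b2 b3 = - varpi b1 (circ b2 b3).

End QuadraticLeibniz.

Section TensorGraded.
Variables (K : fieldType) (P : vectType K) (Q : grading K).

Definition gtens : grading K := fun i => tens P (Q i).

Fact gpure_fsupp (a : P) (x : dsum Q) :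
  ((fun i => a \ox x i) : famprod gtens) \in @fsupp K gtens.
Proof.
case: x => x /= /asboolP xf; apply/asboolP; apply: sub_finite_set xf => i /=.
apply: contraNneq => x0; rewrite x0; apply/eqP/matrixP=> k l.
by rewrite !mxE linear0 mulr0.
Qed.

Definition gpure (a : P) (x : dsum Q) : dsum gtens := DSum (gpure_fsupp a x).

(* The linear map on P (x) Q = (+)_i P (x) Q_i extending f. *)
Definition glift (X : lmodType K) (f : P -> dsum Q -> X) (u : dsum gtens) : X :=
  \sum_(i \in [set: int]%classic) tlift (fun a x => f a (dinj x)) (u i).

Definition bullet (p : tens P P) (q : ctens Q Q) : ctens gtens gtens :=
  fun s => tlift (fun a1 a2 =>
             tlift (fun x1 x2 => (a1 \ox x1) \ox (a2 \ox x2)) (q s)) p.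

Definition PQ_dot (rhd lhd : P -> P -> P) (circ : dsum Q -> dsum Q -> dsum Q)
    (u v : dsum gtens) : dsum gtens :=
  glift (fun a x => glift (fun b y =>
    gpure (rhd a b) (circ x y) - gpure (lhd b a) (circ y x)) v) u.

Definition PQ_delta (brhd blhd : P -> tens P P)
    (theta : dsum Q -> ctens Q Q) : dsum gtens -> ctens gtens gtens :=
  glift (fun a x =>
    bullet (brhd a) (theta x) - bullet (tflip (blhd a)) (cflip (theta x))).

End TensorGraded.

Section Laurent.
Variable K : fieldType.

(* Indices of the basis and of the tables start at 1. *)
Definition eps (n : nat) : 'rV[K]_4 := \row_(j < 4) (j.+1 == n)%:R.

Definition W_table (i j : nat) : 'rV[K]_4 :=
  match i, j with
  | 2%N, 1%N => eps 1
  | 2%N, 2%N => eps 1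
  | 2%N, 3%N => - eps 3 - eps 4
  | 3%N, 1%N => eps 4
  | 3%N, 2%N => eps 3 + 2%:R *: eps 4
  | _, _ => 0
  end.

Definition W_circ (x y : 'rV[K]_4) : 'rV[K]_4 :=
  \sum_(i < 4) \sum_(j < 4) (x 0 i * y 0 j) *: W_table i.+1 j.+1.

Definition nu_table (i j : nat) : K :=
  match i, j with
  | 1%N, 3%N | 2%N, 4%N => 1
  | 3%N, 1%N | 4%N, 2%N => - 1
  | _, _ => 0
  end.

Definition nu (x y : 'rV[K]_4) : K :=
  \sum_(i < 4) \sum_(j < 4) x 0 i * y 0 j * nu_table i.+1 j.+1.

(* dinj x at degree m stands for x (x) t^m. *)
Definition WL : grading K := fun _ => 'rV[K]_4.

Definition WL_circ (x y : dsum WL) : dsum WL :=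
  \sum_(m \in [set: int]%classic) \sum_(n \in [set: int]%classic)
    @dinj K WL (m + n) (W_circ (x m) (y n)).

Definition WL_form (x y : dsum WL) : K^o :=
  \sum_(m \in [set: int]%classic) \sum_(n \in [set: int]%classic)
    nu (x m) (y n) * (m + n == 0)%:R.

End Laurent.

(* Main.v *)
(* Write L for P (x) Q and phi_(f,y) for the form a (x) x |-> f(a) varpi(x, y) on
   L, where f is a form on P and y is in Q.  Since varpi is non-degenerate and
   graded, these forms (with y homogeneous) and their products separate points of
   L, of L (x)^ L and of the threefold product, and it suffices to test every
   identity against them.  There the formal sums disappear: by invariance,
   varpi(w o q, y) = - varpi(q, w o y) and
   varpi(q o w, y) = varpi(q, w o y + y o w), so the transposes of left and right
   multiplication by a (x) w map each phi_(f,y) to a combination of such forms,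
   and by the definition of theta so does the transpose of delta:
     (phi_(f,y) (x) phi_(g,z)) delta
       = - phi_(beta_rhd^*(f (x) g), y o z) + phi_(beta_lhd^*(g (x) f), z o y).
   Each pre-Lie bialgebra axiom thus becomes the vanishing of a combination of
   expressions varpi of four letters, which the Leibniz identity reduces to
   varpi(w, x o (y o z)) over the six orders of x, y, z.  The six coefficients are
   integral combinations of the Zinbiel-dendriform bialgebra axioms, which gives
   (i).  For the Laurent algebra take w = eps_2 and x, y, z = eps_1, eps_2, eps_3
   in any order, all in degree 0: only varpi(eps_2, eps_3 o (eps_2 o eps_1)) = 1
   is nonzero, so the six coefficients vanish one by one, and they in turn span
   the Zinbiel-dendriform axioms over the integers, in every characteristic. *)

From HB Require Import structures.
Require Import Defs.
From mathcomp Require Import all_boot all_order all_algebra.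
From mathcomp Require Import boolp classical_sets functions cardinality fsbigop.
From mathcomp Require Import finmap ring.

Set Implicit Arguments.
Unset Strict Implicit.
Unset Printing Implicit Defensive.

Import GRing.Theory.
Local Open Scope ring_scope.

(** * Finitely supported sums over infinite index types *)

Lemma fsumE (T : choiceType) (V : zmodType) (F : T -> V) (r : seq T) :
  uniq r -> (forall x, x \notin r -> F x = 0) ->
  \sum_(x \in [set: T]%classic) F x = \sum_(x <- r) F x.
Proof.
move=> ur F0; rewrite (fsbigE r) //; last by move=> i _; exact: F0.
by apply: eq_bigl => i; rewrite in_setT.
Qed.

Lemma fsum1 (T : choiceType) (V : zmodType) (F : T -> V) (x0 : T) :
  (forall x, x != x0 -> F x = 0) -> \sum_(x \in [set: T]%classic) F x = F x0.
Proof.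
move=> F0; rewrite (@fsumE _ _ _ [:: x0]) ?big_seq1 // => x.
by rewrite inE => /F0.
Qed.

Lemma finite_supp (T : choiceType) (V : zmodType) (F : T -> V) (r : seq T) :
  (forall x, x \notin r -> F x = 0) -> finite_set [set x | F x != 0]%classic.
Proof.
move=> F0; apply: (@sub_finite_set _ _ [set` r]%classic); last exact: finite_seq.
by move=> x /= Fx; apply: contraNT Fx => /F0 ->.
Qed.

(** * Forms on tensor products *)

Section Linear.
Variables (K : fieldType) (U V : lmodType K) (f : U -> V).
Hypothesis fL : linear f.

Let F : {linear U -> V} := HB.pack f (GRing.isLinear.Build K U V *:%R f fL).

Lemma lin0 : f 0 = 0. Proof. exact: (linear0 F). Qed.
Lemma linD x y : f (x + y) = f x + f y. Proof. exact: (linearD F). Qed.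
Lemma linN x : f (- x) = - f x. Proof. exact: (linearN F). Qed.
Lemma linB x y : f (x - y) = f x - f y. Proof. exact: (linearB F). Qed.
Lemma linZ a x : f (a *: x) = a *: f x. Proof.
by rewrite -[f]/(F : U -> V) linearZ. Qed.
Lemma lin_sum (I : Type) (r : seq I) (P : pred I) (E : I -> U) :
  f (\sum_(i <- r | P i) E i) = \sum_(i <- r | P i) f (E i).
Proof. exact: (linear_sum F). Qed.
End Linear.

Section Tensors.
Variable K : fieldType.

Lemma lin_comp (U V W : lmodType K) (f : V -> W) (g : U -> V) :
  linear f -> linear g -> linear (fun u => f (g u)).
Proof. by move=> fL gL a x y; rewrite gL fL. Qed.

Lemma eq_tlift (U V : vectType K) (X : lmodType K) (f g : U -> V -> X)
    (t : tens U V) : (forall u v, f u v = g u v) -> tlift f t = tlift g t.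
Proof. by move=> fg; apply: eq_bigr => i _; apply: eq_bigr => j _; rewrite fg. Qed.

Lemma tlift_linear (U V : vectType K) (X : lmodType K) (f : U -> V -> X) :
  linear (tlift f).
Proof.
move=> a s t; rewrite /tlift scaler_sumr -big_split; apply: eq_bigr => i _ /=.
rewrite scaler_sumr -big_split; apply: eq_bigr => j _ /=.
by rewrite !mxE scalerDl scalerA.
Qed.

Lemma lin_tlift (U V : vectType K) (X Y : lmodType K) (h : X -> Y)
    (f : U -> V -> X) (t : tens U V) :
  linear h -> h (tlift f t) = tlift (fun u v => h (f u v)) t.
Proof.
move=> hL; rewrite /tlift (lin_sum hL); apply: eq_bigr => i _.
by rewrite (lin_sum hL); apply: eq_bigr => j _; rewrite (linZ hL).
Qed.

Lemma tlift_funD (U V : vectType K) (X : lmodType K) (a : K) (f g : U -> V -> X)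
    (t : tens U V) :
  tlift (fun u v => a *: f u v + g u v) t = a *: tlift f t + tlift g t.
Proof.
rewrite /tlift scaler_sumr -big_split; apply: eq_bigr => i _ /=.
rewrite scaler_sumr -big_split; apply: eq_bigr => j _ /=.
by rewrite scalerDr !scalerA mulrC.
Qed.

Lemma tlift_fun0 (U V : vectType K) (X : lmodType K) (t : tens U V) :
  tlift (fun _ _ => 0 : X) t = 0.
Proof. by rewrite /tlift !big1 // => i _; rewrite big1 // => j _;
  rewrite scaler0. Qed.

(** Values stay in [K], so that [ring] sees products of scalars; the module [K^o] serves to state
    linearity. *)
Definition form (U : lmodType K) (f : U -> K) : Prop := linear (f : U -> K^o).

Section Form.
Variables (U : lmodType K) (f : U -> K).
Hypothesis fL : form f.

Lemma form0 : f 0 = 0. Proof. exact: (lin0 (V := K^o) fL). Qed.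
Lemma formD x y : f (x + y) = f x + f y. Proof. exact: (linD (V := K^o) fL). Qed.
Lemma formN x : f (- x) = - f x. Proof. exact: (linN (V := K^o) fL). Qed.
Lemma formB x y : f (x - y) = f x - f y. Proof. exact: (linB (V := K^o) fL). Qed.
Lemma formZ a x : f (a *: x) = a * f x. Proof. exact: (linZ (V := K^o) fL). Qed.
Lemma form_sum (I : Type) (r : seq I) (A : pred I) (E : I -> U) :
  f (\sum_(i <- r | A i) E i) = \sum_(i <- r | A i) f (E i).
Proof. exact: (lin_sum (V := K^o) fL). Qed.
End Form.

(* The value of f (x) g : U (x) V -> K. *)
Definition pr (U V : vectType K) (f : U -> K) (g : V -> K) (t : tens U V) : K :=
  tlift (fun u v => f u * g v : K^o) t.

Section Pairing.
Variables (U V : vectType K).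
Implicit Types (f : U -> K) (g : V -> K).

Lemma pr_form f g : form (pr f g).
Proof. exact: tlift_linear. Qed.

Lemma mulf_bilinear f g : form f -> form g ->
  is_bilinear (fun u v => f u * g v : K^o).
Proof.
move=> fL gL; split => [v|u] a x y /=.
  by rewrite fL mulrDl -mulrA.
by rewrite gL mulrDr mulrCA.
Qed.

Lemma pr_pure f g u v : form f -> form g -> pr f g (u \ox v) = f u * g v.
Proof. by move=> fL gL; rewrite /pr tlift_pure //; apply: mulf_bilinear. Qed.

Lemma eq_pr f f' g g' t : f =1 f' -> g =1 g' -> pr f g t = pr f' g' t.
Proof. by move=> ff' gg'; apply: (@eq_tlift _ _ K^o) => u v; rewrite ff' gg'. Qed.

(** [pr] is a sum over basis vectors, so linearity in each function argument is pointwise. *)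
Lemma pr_linl g t a f f' :
  pr (fun u => a * f u + f' u) g t = a * pr f g t + pr f' g t.
Proof.
rewrite /pr -[RHS](@tlift_funD U V K^o); apply: (@eq_tlift _ _ K^o) => u v.
by rewrite mulrDl -mulrA.
Qed.

Lemma pr_linr f t a g g' :
  pr f (fun u => a * g u + g' u) t = a * pr f g t + pr f g' t.
Proof.
rewrite /pr -[RHS](@tlift_funD U V K^o); apply: (@eq_tlift _ _ K^o) => u v.
by rewrite mulrDr mulrCA.
Qed.

Lemma pr0l g t : pr (fun _ : U => 0) g t = 0.
Proof. by rewrite /pr -[RHS](@tlift_fun0 U V K^o t);
  apply: (@eq_tlift _ _ K^o) => *; rewrite mul0r. Qed.

Lemma pr0r f t : pr f (fun _ : V => 0) t = 0.
Proof. by rewrite /pr -[RHS](@tlift_fun0 U V K^o t);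
  apply: (@eq_tlift _ _ K^o) => *; rewrite mulr0. Qed.

Lemma pr_tlift (A B : vectType K) f g (h : A -> B -> tens U V) t :
  pr f g (tlift h t) = tlift (fun u v => pr f g (h u v) : K^o) t.
Proof. by apply: (@lin_tlift _ _ _ K^o (pr f g)); apply: pr_form. Qed.

Lemma pr_tmap (A B : vectType K) f g (h : A -> U) (k : B -> V) t :
  form f -> form g ->
  pr f g (tmap h k t) = pr (fun u => f (h u)) (fun v => g (k v)) t.
Proof.
by move=> fL gL; rewrite pr_tlift; apply: (@eq_tlift _ _ K^o) => u v;
  rewrite pr_pure.
Qed.

End Pairing.

Lemma tflip_linear (U V : vectType K) : linear (@tflip K U V).
Proof. exact: tlift_linear. Qed.

Lemma pr_tflip (U V : vectType K) (f : V -> K) (g : U -> K) (t : tens U V) :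
  form f -> form g -> pr f g (tflip t) = pr g f t.
Proof.
move=> fL gL; rewrite pr_tlift; apply: (@eq_tlift _ _ K^o) => u v.
by rewrite pr_pure // mulrC.
Qed.

Lemma pr_tcons (U V W : vectType K) (f : U -> K) (g : V -> K) (h : W -> K)
    (u : U) (t : tens V W) : form f -> form g -> form h ->
  pr (pr f g) h (tcons u t) = f u * pr g h t.
Proof.
move=> fL gL hL.
have mL : linear (fun x : K^o => f u * x : K^o) by move=> a x y;
  rewrite mulrDr mulrCA.
rewrite pr_tlift; apply: (etrans _ (esym (lin_tlift _ t mL))).
apply: (@eq_tlift _ _ K^o) => v w; rewrite -[LHS]/(pr (pr f g) h _).
by rewrite !pr_pure ?mulrA //; apply: pr_form.
Qed.

(** Stated for a family of forms rather than for the whole dual: on a piece of [Q] the family of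
    interest consists of the forms [varpi (-, y)]. *)
Definition separates (U : lmodType K) (F : (U -> K) -> Prop) : Prop :=
  (forall f, F f -> form f) /\ forall u, (forall f, F f -> f u = 0) -> u = 0.

Definition prs (U V : vectType K) (F : (U -> K) -> Prop) (G : (V -> K) -> Prop) :
    (tens U V -> K) -> Prop :=
  fun phi => exists f g, [/\ F f, G g & phi = pr f g].

Lemma coord_form (U : vectType K) n (b : n.-tuple U) i : form (coord b i).
Proof. by move=> a x y; rewrite linearP. Qed.

Lemma form_separates (U : vectType K) : separates (@form U).
Proof.
split=> // u fu; rewrite (coord_vbasis (memvf u)) big1 // => i _.
by rewrite fu ?scale0r //; apply: coord_form.
Qed.

Lemma pr_coord (U V : vectType K) (t : tens U V) i j :
  pr (coord (vbasis {:U}) i) (coord (vbasis {:V}) j) t = (t : 'M[K]__) i j.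
Proof.
have bU := basis_free (vbasisP {:U}); have bV := basis_free (vbasisP {:V}).
rewrite /pr /tlift (bigD1 i) //= [X in _ + X]big1 ?addr0; last first.
  move=> k ki; rewrite big1 // => l _.
  by rewrite coord_free // (negPf ki) mul0r scaler0.
rewrite (bigD1 j) //= [X in _ + X]big1 ?addr0; last first.
  by move=> k kj; rewrite !coord_free // (negPf kj) mulr0 scaler0.
by rewrite !coord_free // !eqxx mulr1 /GRing.scale /= mulr1.
Qed.

(** Contracting [t] with some [f] in [F] leaves a vector of [V] killed by all of [G], hence 0. So
    contracting [t] with any form on [V] leaves a vector of [U] killed by all of [F], hence 0. With
    coordinate forms, every matrix entry of [t] is 0. *)
Lemma prs_separates (U V : vectType K) (F : (U -> K) -> Prop)
    (G : (V -> K) -> Prop) :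
  separates F -> separates G -> separates (prs F G).
Proof.
move=> [FL Fs] [GL Gs]; split=> [_ [f [g [_ _ ->]]] | t t0]; first exact: pr_form.
have vL f : linear (fun t : tens U V => tlift (fun u v => f u *: v) t).
  exact: tlift_linear.
have uL g : linear (fun t : tens U V => tlift (fun u v => g v *: u) t).
  exact: tlift_linear.
have fgv f g : form g -> g (tlift (fun u v => f u *: v) t) = pr f g t.
  move=> gL; rewrite (@lin_tlift _ _ _ K^o g) //.
  by apply: (@eq_tlift _ _ K^o) => u v; rewrite (formZ gL).
have fgu f g : form f -> f (tlift (fun u v => g v *: u) t) = pr f g t.
  move=> fL; rewrite (@lin_tlift _ _ _ K^o f) //; apply: (@eq_tlift _ _ K^o) => u v.
  by rewrite (formZ fL) mulrC.
have tv f : F f -> tlift (fun u v => f u *: v) t = 0.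
  move=> Ff; apply: Gs => g Gg; rewrite fgv; last exact: GL.
  by apply: t0; exists f, g.
have tu g : form g -> tlift (fun u v => g v *: u) t = 0.
  move=> gL; apply: Fs => f Ff; rewrite fgu; last exact: FL.
  by rewrite -fgv // tv // (form0 gL).
apply/matrixP => i j; rewrite -pr_coord -fgu; last exact: coord_form.
by rewrite tu ?linear0 ?mxE //; apply: coord_form.
Qed.

End Tensors.

(** * Completed tensor products *)

Section DirectSums.
Variables (K : fieldType) (U : grading K).
Implicit Types x y : dsum U.

Lemma dsum_ext x y : (forall i, x i = y i) -> x = y.
Proof.
by move=> xy; apply: val_inj; apply: functional_extensionality_dep => i; apply: xy.
Qed.

Lemma component_linear i : linear (fun x => x i).
Proof. by []. Qed.

Lemma dinj_same i (u : U i) : dinj u i = u.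
Proof. exact: dfwith_in. Qed.

Lemma dinj_out i (u : U i) j : j != i -> dinj u j = 0.
Proof. by move=> ji; rewrite [LHS]dfwith_out // eq_sym. Qed.

Lemma dinj_linear i : linear (@dinj K U i).
Proof.
move=> a u v; apply: dsum_ext => j; rewrite component_linear.
have [-> | ji] := eqVneq j i; first by rewrite !dinj_same.
by rewrite !dinj_out // scaler0 addr0.
Qed.

Lemma dsum_supp x : exists2 r : seq int, uniq r & forall i, i \notin r -> x i = 0.
Proof.
have /asboolP xf := valP x.
exists (fset_set [set i | x i != 0]%classic) => [|i]; first exact: fset_uniq.
by rewrite in_fset_set // notin_setE /= => /negP; rewrite negbK => /eqP.
Qed.

Lemma dsum_decomp x (r : seq int) : uniq r -> (forall i, i \notin r -> x i = 0) ->
  x = \sum_(i <- r) dinj (x i).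
Proof.
move=> ur x0; apply: dsum_ext => i.
have -> : (\sum_(j <- r) dinj (x j)) i = \sum_(j <- r) dinj (x j) i.
  exact: (lin_sum (component_linear i)).
have [ir|ir] := boolP (i \in r); last first.
  rewrite x0 // big_seq big1 // => j jr; rewrite dinj_out //.
  by apply: contraNneq ir => ->.
rewrite (bigD1_seq i) // dinj_same big1 => [|j ji]; first exact: esym (addr0 _).
by rewrite dinj_out // eq_sym.
Qed.

Lemma dsum_eq (X : lmodType K) (h h' : dsum U -> X) : linear h -> linear h' ->
  (forall i (u : U i), h (dinj u) = h' (dinj u)) -> h =1 h'.
Proof.
move=> hL h'L hh' x; have [r ur x0] := dsum_supp x.
rewrite [x in LHS](dsum_decomp ur x0) [x in RHS](dsum_decomp ur x0).
by rewrite (lin_sum hL) (lin_sum h'L); apply: eq_bigr.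
Qed.

(* Forms on the direct sum that vanish on almost all pieces. *)
Definition finform (xi : dsum U -> K) : Prop :=
  form xi /\
  exists r : seq int, forall i (u : U i), i \notin r -> xi (dinj u) = 0.

Lemma finform_lin a xi xi' : finform xi -> finform xi' ->
  finform (fun u => a * xi u + xi' u).
Proof.
move=> [xL [r r0]] [x'L [r' r'0]]; split.
  move=> b u v; rewrite xL x'L /GRing.scale /=; ring.
exists (r ++ r') => i u; rewrite mem_cat negb_or => /andP[ir ir'].
by rewrite r0 // r'0 // mulr0 addr0.
Qed.

End DirectSums.

Section CompletedPairing.
Variable K : fieldType.

(* The value of xi (x) eta on a formal sum, meaningful for finforms. *)
Definition pair2 (U V : grading K) (xi : dsum U -> K) (eta : dsum V -> K)
    (t : ctens U V) : K :=
  \sum_(ij \in [set: int * int]%classic)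
    pr (fun u => xi (dinj u)) (fun v => eta (dinj v)) (t ij).

Lemma finform_seq (U : grading K) (xi : dsum U -> K) : finform xi ->
  exists2 r : seq int, uniq r &
    forall i (u : U i), i \notin r -> xi (dinj u) = 0.
Proof.
move=> [_ [r r0]]; exists (undup r); first exact: undup_uniq.
by move=> i u; rewrite mem_undup; apply: r0.
Qed.

Section Lemmas.
Variables (U V : grading K).
Implicit Types (xi : dsum U -> K) (eta : dsum V -> K) (t : ctens U V).

(** Any lists containing the supports compute the sum, so several forms can be compared over one
    common list. *)
Lemma pair2E xi eta (r r' : seq int) t : uniq r -> uniq r' ->
  (forall i (u : U i), i \notin r -> xi (dinj u) = 0) ->
  (forall i (u : V i), i \notin r' -> eta (dinj u) = 0) ->
  pair2 xi eta t = \sum_(ij <- allpairs pair r r')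
    pr (fun u => xi (dinj u)) (fun v => eta (dinj v)) (t ij).
Proof.
move=> ur ur' r0 r'0; rewrite /pair2 (@fsumE _ _ _ (allpairs pair r r')) //.
  by rewrite allpairs_uniq // => -[? ?] [? ?].
move=> [i j] ij; have [ir|ir] := boolP (i \in r); last first.
  by rewrite -[RHS](pr0l (fun v => eta (dinj v)) (t (i, j)));
    apply: eq_pr => // u; exact: r0.
have jr' : j \notin r'.
  by apply: contraNN ij => jr'; rewrite allpairs_f.
by rewrite -[RHS](pr0r (fun v => xi (dinj v)) (t (i, j))); apply: eq_pr => // u;
  exact: r'0.
Qed.

Lemma eq_pair2 xi xi' eta eta' t : xi =1 xi' -> eta =1 eta' ->
  pair2 xi eta t = pair2 xi' eta' t.
Proof. by move=> /funext -> /funext ->. Qed.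

Lemma pair2_form xi eta : finform xi -> finform eta ->
  linear (pair2 xi eta : ctens U V -> K^o).
Proof.
move=> /finform_seq[r ur r0] /finform_seq[r' ur' r'0] a s t.
rewrite !(pair2E _ ur ur' r0 r'0) scaler_sumr -big_split; apply: eq_bigr => ij _ /=.
exact: pr_form.
Qed.

Lemma pair2_linl a xi xi' eta t : finform xi -> finform xi' -> finform eta ->
  pair2 (fun u => a * xi u + xi' u) eta t = a * pair2 xi eta t + pair2 xi' eta t.
Proof.
move=> /finform_seq[r ur r0] /finform_seq[q uq q0] /finform_seq[r' ur' r'0].
pose p := undup (r ++ q); have up : uniq p by exact: undup_uniq.
have p1 i (u : U i) : i \notin p -> xi (dinj u) = 0.
  by rewrite mem_undup mem_cat negb_or => /andP[/r0].
have p2 i (u : U i) : i \notin p -> xi' (dinj u) = 0.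
  by rewrite mem_undup mem_cat negb_or => /andP[_ /q0].
have p3 i (u : U i) : i \notin p -> a * xi (dinj u) + xi' (dinj u) = 0.
  by move=> ip; rewrite p1 // p2 // mulr0 addr0.
rewrite (pair2E _ up ur' p1 r'0) (pair2E _ up ur' p2 r'0) (pair2E _ up ur' p3 r'0).
by rewrite mulr_sumr -big_split; apply: eq_bigr => ij _; rewrite pr_linl.
Qed.

End Lemmas.

Lemma pair2_cflip (U V : grading K) (xi : dsum V -> K) (eta : dsum U -> K)
    (t : ctens U V) : form xi -> form eta ->
      pair2 xi eta (cflip t) = pair2 eta xi t.
Proof.
move=> xL eL; pose sw (ij : int * int) := (ij.2, ij.1).
have bsw : bijective sw by exists sw => -[].
rewrite /pair2 (reindex_fsbigT sw _ bsw); apply: eq_fsbigr => -[i j] _.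
by rewrite /cflip /= pr_tflip //; apply: lin_comp => //; apply: dinj_linear.
Qed.

Lemma pair2_linr (U V : grading K) a (xi : dsum U -> K) (eta eta' : dsum V -> K) t :
  finform xi -> finform eta -> finform eta' ->
  pair2 xi (fun u => a * eta u + eta' u) t = a * pair2 xi eta t + pair2 xi eta' t.
Proof.
move=> fx fe fe'; have fl := finform_lin a fe fe'.
(* The flip is an involution, so linearity on the right follows from linearity on the left. *)
have ff : cflip (cflip t) = t.
  apply: functional_extensionality_dep => -[i j]; apply/matrixP => k l.
  by rewrite -!pr_coord /cflip /= !pr_tflip //; exact: coord_form.
have [[xL _] [eL _] [e'L _] [lL _]] := (And4 fx fe fe' fl).
by rewrite -ff (pair2_cflip _ xL lL) (pair2_cflip _ xL eL)
  (pair2_cflip _ xL e'L) pair2_linl.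
Qed.

(* Linear maps each of whose components vanishes on almost all pieces: the maps
   that extend to the completed tensor product. *)
Definition cont (U V : grading K) (f : dsum U -> dsum V) : Prop :=
  linear f /\ forall j, exists r : seq int,
    forall i (u : U i), i \notin r -> f (dinj u) j = 0.

Lemma cont_id (U : grading K) : cont (@id (dsum U)).
Proof.
split=> // j; exists [:: j] => i u; rewrite inE eq_sym => ij.
exact: dinj_out.
Qed.

Lemma cont_lin (U V : grading K) a (f g : dsum U -> dsum V) :
  cont f -> cont g -> cont (fun u => a *: f u + g u).
Proof.
move=> [fL fc] [gL gc]; split=> [b u v|j].
  by rewrite fL gL !scalerDr !scalerA mulrC addrACA.
have [[r r0] [r' r'0]] := (fc j, gc j).
exists (r ++ r') => i u; rewrite mem_cat negb_or => /andP[ir ir'].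
by rewrite component_linear r0 // r'0 // scaler0 addr0.
Qed.

Section Extension.
Variables (U V : grading K) (S : Type) (X : S -> vectType K).
Variables (f : dsum U -> dsum V -> famprod X) (s : S) (r : seq (int * int)).
Hypothesis f0 : forall ij (u : U ij.1) (v : V ij.2), ij \notin r ->
  f (dinj u) (dinj v) s = 0.

Lemma cterm0 t ij : ij \notin r -> cterm f t s ij = 0.
Proof.
move=> ijr; rewrite -[RHS](tlift_fun0 _ (t ij)).
by apply: eq_tlift => u v; apply: f0.
Qed.

(** Only the indices in [r] contribute to the component [s], so the sum is finite there and commutes
    with [phi]. *)
Lemma cext_form (phi : X s -> K) t : form phi ->
  phi (cext f t s) = \sum_(ij \in [set: int * int]%classic)
    tlift (fun u v => phi (f (dinj u) (dinj v) s) : K^o) (t ij).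
Proof.
move=> pL; have pL' : linear (phi : X s -> K^o) by [].
have ct ij : phi (cterm f t s ij) =
    tlift (fun u v => phi (f (dinj u) (dinj v) s) : K^o) (t ij).
  exact: (lin_tlift _ _ pL').
have c0 ij : ij \notin undup r -> cterm f t s ij = 0.
  by rewrite mem_undup; apply: cterm0.
rewrite /cext (fsumE (undup_uniq r) c0) (lin_sum pL').
rewrite (fsumE (undup_uniq r)) => [|ij ijr]; first exact: eq_bigr.
by rewrite -ct c0 // (lin0 pL').
Qed.
End Extension.

Section Maps.
Variables (U V U' V' : grading K).
Variables (f : dsum U -> dsum U') (g : dsum V -> dsum V').
Hypotheses (fc : cont f) (gc : cont g).

Lemma pure0l (A B : vectType K) (b : B) : (0 : A) \ox b = 0.
Proof. exact: (lin0 (fun a x y => (pure_bilinear A B).1 b a x y)). Qed.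

Lemma pure0r (A B : vectType K) (a : A) : a \ox (0 : B) = 0.
Proof. exact: (lin0 (fun c x y => (pure_bilinear A B).2 a c x y)). Qed.

(** Only finitely many degrees reach degree [s.1] under [f], and only finitely many reach [s.2]
    under [g]; any other pair of degrees gives a zero tensor factor. *)
Lemma cmap_supp s : exists r : seq (int * int), forall (ij : int * int)
  (u : U ij.1) (v : V ij.2),
  ij \notin r -> tens_fun f g (dinj u) (dinj v) s = 0.
Proof.
have [[r r0] [r' r'0]] := (fc.2 s.1, gc.2 s.2).
exists (allpairs pair r r') => -[i j] /= u v ij; rewrite /tens_fun.
have [ir|ir] := boolP (i \in r); last by rewrite r0 // pure0l.
by rewrite r'0 ?pure0r //; apply: contraNN ij => jr'; rewrite allpairs_f.
Qed.

Lemma cont_cmap_defined t : cmap_defined f g t.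
Proof.
move=> s; have [r r0] := cmap_supp s.
apply: (@finite_supp _ _ (cterm (tens_fun f g) t s) r) => ij;
  exact: (cterm0 (f := tens_fun f g) r0).
Qed.

(** Transposition: the maps [f] and [g] move onto the forms and the formal sum [t] stays as it
    is. *)
Lemma pr_cmap s (h : U' s.1 -> K) (k : V' s.2 -> K) t : form h -> form k ->
  pr h k (cmap f g t s) = pair2 (fun u => h (f u s.1)) (fun v => k (g v s.2)) t.
Proof.
move=> hL kL; have [r r0] := cmap_supp s.
rewrite (@cext_form U V _ _ (tens_fun f g) s r r0 (pr h k)); last exact: pr_form.
apply: eq_fsbigr => ij _; by apply: (@eq_tlift _ _ _ K^o) => u v; rewrite pr_pure.
Qed.

End Maps.
End CompletedPairing.

(** * The graded space P (x) Q and linear maps on it *)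

Section GradedTensor.
Variables (K : fieldType) (P : vectType K) (Q : grading K).
Local Notation L := (gtens P Q).

Lemma gpure_linl (x : dsum Q) : linear (@gpure K P Q ^~ x).
Proof.
by move=> c a b; apply: dsum_ext => i; exact: (pure_bilinear P (Q i)).1.
Qed.

Lemma gpure_linr (a : P) : linear (@gpure K P Q a).
Proof.
by move=> c x y; apply: dsum_ext => i; exact: (pure_bilinear P (Q i)).2.
Qed.

Lemma gpure_dinj (a : P) i (x : Q i) : gpure a (dinj x) = @dinj K L i (a \ox x).
Proof.
apply: dsum_ext => j; rewrite -[LHS]/(a \ox (dinj x j)).
have [->|ji] := eqVneq j i; first by rewrite !dinj_same.
by rewrite !dinj_out // pure0r.
Qed.

(** Homogeneous pure tensors span: an element is the finite sum of its components, and each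
    component is a combination of pure tensors of basis vectors. *)
Lemma gtens_ind (A : dsum L -> Prop) :
  A 0 -> (forall c u v, A u -> A v -> A (c *: u + v)) ->
  (forall a i (x : Q i), A (gpure a (dinj x))) -> forall u, A u.
Proof.
move=> A0 AD Ap u.
have Asum (I : eqType) (r : seq I) (c : I -> K) (E : I -> dsum L) :
    (forall i, A (E i)) -> A (\sum_(i <- r) c i *: E i).
  by move=> AE; elim/big_rec: _ => // i v _; apply: AD.
have [r ur u0] := dsum_supp u; rewrite (dsum_decomp ur u0).
rewrite (eq_bigr (fun i => 1 *: dinj (u i))); last by move=> *; rewrite scale1r.
apply: (Asum) => i; rewrite -(tlift_unique (h := @dinj K L i));
  last exact: dinj_linear.
rewrite /tlift (eq_bigr (fun k => 1 *: \sum_l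
    (u i : 'M[K]__) k l *: dinj ((vbasis {:P})`_k \ox (vbasis {:Q i})`_l : L i))).
  by apply: (Asum) => k; apply: (Asum) => l; rewrite -gpure_dinj.
by move=> *; rewrite scale1r.
Qed.

Lemma gtens_eq (X : lmodType K) (h h' : dsum L -> X) : linear h -> linear h' ->
  (forall a i (x : Q i), h (gpure a (dinj x)) = h' (gpure a (dinj x))) ->
  h =1 h'.
Proof.
move=> hL h'L; apply: gtens_ind => [|c u v hu hv]; first by rewrite !lin0.
by rewrite hL h'L hu hv.
Qed.

Section Lift.
Variable X : lmodType K.
Implicit Types f g : P -> dsum Q -> X.

Lemma gliftE f (u : dsum L) (r : seq int) : uniq r ->
  (forall i, i \notin r -> u i = 0) ->
  glift f u = \sum_(i <- r) tlift (fun a x => f a (dinj x)) (u i).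
Proof.
move=> ur u0; apply: fsumE => // i ir; rewrite u0 //.
exact: (lin0 (@tlift_linear _ _ _ _ _)).
Qed.

Lemma glift_linear f : linear (glift f).
Proof.
move=> c u v; have [r ur u0] := dsum_supp u; have [r' ur' v0] := dsum_supp v.
pose p := undup (r ++ r'); have up : uniq p by exact: undup_uniq.
have pu i : i \notin p -> u i = 0.
  by rewrite mem_undup mem_cat negb_or => /andP[/u0].
have pv i : i \notin p -> v i = 0.
  by rewrite mem_undup mem_cat negb_or => /andP[_ /v0].
have puv i : i \notin p -> (c *: u + v) i = 0.
  by move=> ip; rewrite component_linear pu // pv // scaler0 addr0.
rewrite (gliftE _ up pu) (gliftE _ up pv) (gliftE _ up puv).
rewrite scaler_sumr -big_split; apply: eq_bigr => i _.
exact: tlift_linear.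
Qed.

Lemma eq_glift f g : (forall a x, f a x = g a x) -> glift f =1 glift g.
Proof.
by move=> fg u; apply: eq_fsbigr => i _; apply: eq_tlift => a x; rewrite fg.
Qed.

(** [glift] works piece by piece; linearity of [f a] reassembles the value at an inhomogeneous
    [x]. *)
Lemma glift_pure f a x : is_bilinear f -> glift f (gpure a x) = f a x.
Proof.
move=> fB; have [r ur x0] := dsum_supp x.
have fs a' : linear (f a') := fB.2 a'.
rewrite [x in RHS](dsum_decomp ur x0) (lin_sum (fs a)) (gliftE _ ur).
  apply: eq_bigr => i _; rewrite -[gpure a x i]/(a \ox x i) tlift_pure //.
  split=> [y|b]; first exact: fB.1.
  by move=> c y z; rewrite dinj_linear fs.
by move=> i /x0 xi0; rewrite -[gpure a x i]/(a \ox x i) xi0 pure0r.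
Qed.

Lemma glift_funlin c f g u :
  glift (fun a x => c *: f a x + g a x) u = c *: glift f u + glift g u.
Proof.
have [r ur u0] := dsum_supp u; rewrite !(gliftE _ ur u0).
rewrite scaler_sumr -big_split; apply: eq_bigr => i _.
exact: tlift_funD.
Qed.

End Lift.

End GradedTensor.

(** * Quadratic graded Leibniz algebras *)

Section Quadratic.
Variables (K : fieldType) (Q : grading K).
Variables (circ : dsum Q -> dsum Q -> dsum Q) (varpi : dsum Q -> dsum Q -> K^o).
Hypothesis qQ : quadratic_graded_leibniz circ varpi.
Variable m : int.
Hypothesis deg_varpi : forall (i j : int) (x : Q i) (y : Q j),
  i + j + m != 0 -> varpi (dinj x) (dinj y) = 0.

Lemma circ_linl y : linear (circ^~ y). Proof. exact: (qgl_bilinear qQ).1. Qed.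
Lemma circ_linr x : linear (circ x). Proof. exact: (qgl_bilinear qQ).2. Qed.
Lemma varpi_linl y : linear (varpi^~ y).
Proof. exact: (qgl_form_bilinear qQ).1. Qed.
Lemma varpi_linr x : linear (varpi x).
Proof. exact: (qgl_form_bilinear qQ).2. Qed.

Lemma circ_deg i j (x : Q i) (y : Q j) k : k != i + j ->
  circ (dinj x) (dinj y) k = 0.
Proof. by case: (qgl_graded qQ x y) => z -> ?; apply: dinj_out. Qed.

Lemma varpi_circ_deg i j k (x : Q i) (y : Q j) (z : Q k) :
  i + (j + k) + m != 0 -> varpi (dinj x) (circ (dinj y) (dinj z)) = 0.
Proof. by case: (qgl_graded qQ y z) => w ->; apply: deg_varpi. Qed.

Lemma varpi_fin y : finform (varpi^~ y : dsum Q -> K).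
Proof.
split; first exact: varpi_linl.
(* The piece of [y] in degree [k] pairs with degree [- (k + m)] only. *)
have [r ur y0] := dsum_supp y; exists [seq - (k + m) | k <- r] => i x ir.
rewrite (dsum_decomp ur y0) (lin_sum (varpi_linr _)) big_seq big1 // => k kr.
apply: deg_varpi; apply: contraNneq ir => ikm; apply/mapP; exists k => //.
by apply/eqP; rewrite -addr_eq0 addrA ikm.
Qed.

Lemma form_varpi i (y : dsum Q) : form (fun x : Q i => varpi (dinj x) y).
Proof. by move=> c x x'; rewrite dinj_linear varpi_linl. Qed.

Definition vform (i : int) (h : Q i -> K) : Prop :=
  exists j (y : Q j), i + j + m = 0 /\ h = fun x => varpi (dinj x) (dinj y).

(** An element of [Q i] is orthogonal for degree reasons to every piece except the one of degree
    [- (i + m)]. If it is orthogonal to that piece too, non-degeneracy on all of [Q] makes it 0. *)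
Lemma vform_separates i : separates (@vform i).
Proof.
split=> [_ [j [y [_ ->]]] | x x0]; first exact: form_varpi.
rewrite -(dinj_same x) (_ : dinj x = 0) //.
apply: (qgl_form_nondegenerate qQ) => y.
apply: (@dsum_eq _ _ K^o _ (fun=> 0)) => [||j z]; first exact: varpi_linr.
  by move=> c u v; rewrite scaler0 addr0.
have [ij|ij] := eqVneq (i + j + m) 0; last exact: deg_varpi.
by apply: (x0 (fun x => varpi (dinj x) (dinj z))); exists j, z.
Qed.

Lemma varpi_skew x y : varpi x y = - varpi y x.
Proof. exact: (qgl_form_skew qQ). Qed.

Lemma circ_adjr w q y : varpi (circ q w) y = varpi q (circ w y + circ y w).
Proof. exact: (qgl_form_invariant qQ). Qed.

(** The right-hand side of invariance is symmetric in its last two letters, so using invariance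
    forwards and then backwards exchanges [q] and [y]; skew-symmetry gives the sign. *)
Lemma circ_adjl w q y : varpi (circ w q) y = - varpi q (circ w y).
Proof. by rewrite circ_adjr addrC -circ_adjr varpi_skew. Qed.

(** The basis of the piece of degree [- (i + m)] dual to the chosen basis of [Q i] under [varpi],
    stated as an expansion formula. The degree [j] is tied to [i] by an equation, which avoids
    transport between equal degrees. *)
Lemma dual_basis_ex i : exists e : 'I_(\dim {:Q i}) -> dsum Q,
  forall j (y : Q j), i + j + m = 0 ->
  dinj y = \sum_(k < \dim {:Q i}) (varpi (dinj (vbasis {:Q i})`_k)
    (dinj y) : K) *: e k.
Proof.
pose b := vbasis {:Q i}; have bf : free b := basis_free (vbasisP _).
pose b' := vbasis {:Q (- (i + m))}.
pose G : 'M[K]_(\dim {:Q i}, \dim {:Q (- (i + m))}) :=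
  \matrix_(k, l) varpi (dinj b`_k) (dinj b'`_l).
(* A linear relation between the rows of the Gram matrix is an element of [Q i] orthogonal to the
   piece of degree [- (i + m)], hence 0. *)
have Gfree : row_free G.
  apply: inj_row_free => v vG0.
  set x := \sum_(k < \dim {:Q i}) v 0 k *: b`_k.
  have xG (l : 'I_(\dim {:Q (- (i + m))})) : varpi (dinj x) (dinj b'`_l) = 0.
    rewrite (form_sum (form_varpi (dinj b'`_l))).
    rewrite -[RHS](_ : (v *m G) 0 l = 0); last by rewrite vG0 mxE.
    rewrite mxE; apply: eq_bigr => k _; rewrite mxE.
    by rewrite (formZ (form_varpi (dinj b'`_l))).
  suff : x = 0 by move=> /(freeP bf) v0; apply/rowP => k; rewrite v0 mxE.
  clearbody x; apply: (vform_separates i).2 => _ [j [y [ijm ->]]].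
  have jE : j = - (i + m) by apply/eqP; rewrite -addr_eq0 [j + _]addrC addrAC ijm.
  subst j; rewrite (coord_vbasis (memvf y)).
  rewrite (lin_sum (@dinj_linear _ _ _)) (lin_sum (varpi_linr _)) big1 // => l _.
  by rewrite (linZ (@dinj_linear _ _ _)) (linZ (varpi_linr _)) xG scaler0.
have [B GB] := row_freeP Gfree.
(* The columns of a right inverse of the Gram matrix give the coordinates of the dual vectors. *)
pose e k : dsum Q := \sum_l B l k *: dinj b'`_l.
have eE (j k : 'I_(\dim {:Q i})) : varpi (dinj b`_j) (e k) = (j == k)%:R.
  rewrite (lin_sum (varpi_linr _)).
  rewrite -[RHS](_ : (G *m B) j k = _); last by rewrite GB mxE.
  rewrite mxE; apply: eq_bigr => l _.
  by rewrite (linZ (varpi_linr _)) mxE mulrC.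
(* The difference between [y] and its expansion is orthogonal to all of [Q]: by degree outside
   [Q i], by duality on the basis of [Q i]. *)
exists e => j y ijm; apply/eqP; rewrite -subr_eq0; apply/eqP.
apply: (qgl_form_nondegenerate qQ) => x; rewrite varpi_skew.
suff -> : varpi x (dinj y - \sum_(k < \dim {:Q i}) (varpi (dinj b`_k)
  (dinj y) : K) *: e k) = 0.
  by rewrite oppr0.
move: x; apply: (@dsum_eq _ _ K^o (varpi^~ _) (fun=> 0)) => [||i' x];
  first exact: varpi_linl.
  by move=> c u v; rewrite scaler0 addr0.
rewrite (linB (varpi_linr _)) (lin_sum (varpi_linr _)).
have [i'i|i'i] := eqVneq i' i; last first.
  rewrite deg_varpi ?sub0r; last first.
    by apply: contra_neq i'i => i'0; apply/(addIr j)/(addIr m); rewrite i'0 ijm.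
  rewrite big1 ?oppr0 // => k _; rewrite (linZ (varpi_linr _)).
  rewrite (lin_sum (varpi_linr _)) big1 ?scaler0 // => l _.
  rewrite (linZ (varpi_linr _)) deg_varpi ?scaler0 //.
  by rewrite addrAC subr_eq0 -subr_eq addrK.
subst i'; rewrite (coord_vbasis (memvf x)).
rewrite (form_sum (form_varpi (dinj y))).
rewrite -sumrB big1 // => k _; apply/eqP; rewrite subr_eq0; apply/eqP.
rewrite (formZ (form_varpi (dinj y))).
rewrite (linZ (varpi_linr _)).
rewrite (form_sum (form_varpi (e k))).
rewrite (bigD1 k) //= big1 ?addr0 => [|l lk].
  rewrite (formZ (form_varpi (e k))) eE eqxx.
  by rewrite /GRing.scale /= mulr1 mulrC.
by rewrite (formZ (form_varpi (e k))) eE (negPf lk) mulr0.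
Qed.

Definition dual_basis i : 'I_(\dim {:Q i}) -> dsum Q :=
  projT1 (cid (dual_basis_ex i)).

Lemma dual_basisE i j (y : Q j) : i + j + m = 0 ->
  dinj y = \sum_(k < \dim {:Q i}) (varpi (dinj (vbasis {:Q i})`_k)
    (dinj y) : K) *: dual_basis k.
Proof. by move=> ijm; apply: (projT2 (cid (dual_basis_ex i))). Qed.

End Quadratic.

(** * Existence and uniqueness of theta *)

Section Copairing.
Variables (K : fieldType) (Q : grading K).
Variables (circ : dsum Q -> dsum Q -> dsum Q) (varpi : dsum Q -> dsum Q -> K^o).
Hypothesis qQ : quadratic_graded_leibniz circ varpi.
Variable m : int.
Hypothesis deg_varpi : forall (i j : int) (x : Q i) (y : Q j),
  i + j + m != 0 -> varpi (dinj x) (dinj y) = 0.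

Lemma pair2_hom (U V : grading K) (xi : dsum U -> K) (eta : dsum V -> K) i j
    (t : ctens U V) :
  (forall i' (u : U i'), i' != i -> xi (dinj u) = 0) ->
  (forall j' (v : V j'), j' != j -> eta (dinj v) = 0) ->
  pair2 xi eta t = pr (fun u => xi (dinj u)) (fun v => eta (dinj v)) (t (i, j)).
Proof.
move=> x0 e0; apply: fsum1 => -[i' j'] ij'.
have [i'i|i'i] := eqVneq i' i; last first.
  rewrite -[RHS](pr0l (fun v => eta (dinj v)) (t (i', j'))).
  by apply: eq_pr => // u; exact: x0.
rewrite -[RHS](pr0r (fun v => xi (dinj v)) (t (i', j'))).
apply: eq_pr => // u; apply: e0; apply: contraNneq ij' => /= ->.
by rewrite i'i.
Qed.

(** On homogeneous arguments all terms but one vanish for degree reasons, and the completed pairing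
    reads a single component. *)
Lemma varpi_hat_hom j j' (y : Q j) (z : Q j') i i' t :
  i + j + m = 0 -> i' + j' + m = 0 ->
  varpi_hat varpi t (dinj y) (dinj z) =
  pr (fun u => varpi (dinj u) (dinj y)) (fun v => varpi (dinj v) (dinj z))
    (t (i, i')).
Proof.
have out (k k' : int) (w : Q k) (u : Q k') l :
    l + k + m = 0 -> k' != l -> varpi (dinj u) (dinj w) = 0.
  move=> lkm k'l; apply: deg_varpi; apply: contra_neq k'l => k'km.
  by apply/(addIr k)/(addIr m); rewrite k'km.
move=> ijm ijm'; apply: (@pair2_hom _ _ (varpi^~ _) (varpi^~ _)) => k u ki.
  exact: out ijm ki.
exact: out ijm' ki.
Qed.

Lemma varpi_hat_linl t z : linear (fun y => varpi_hat varpi t y z : K^o).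
Proof.
move=> c y y'; rewrite -[RHS](@pair2_linl _ _ _ c (varpi^~ y) (varpi^~ y')
  (varpi^~ z)).
- rewrite -[LHS]/(pair2 (varpi^~ _) (varpi^~ _) t).
  by rewrite (@eq_pair2 _ _ _ _ (fun u => c * varpi u y
    + varpi u y') _ (varpi^~ z)) // => u; rewrite (varpi_linr qQ).
- exact: (varpi_fin qQ deg_varpi y).
- exact: (varpi_fin qQ deg_varpi y').
- exact: (varpi_fin qQ deg_varpi z).
Qed.

Lemma varpi_hat_linr t y : linear (fun z => varpi_hat varpi t y z : K^o).
Proof.
move=> c z z'; rewrite -[RHS](@pair2_linr _ _ _ c (varpi^~ y) (varpi^~ z)
  (varpi^~ z')).
- rewrite -[LHS]/(pair2 (varpi^~ _) (varpi^~ _) t).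
  by rewrite (@eq_pair2 _ _ _ _ (varpi^~ y) _ (fun u => c * varpi u z
    + varpi u z')) // => u; rewrite (varpi_linr qQ).
- exact: (varpi_fin qQ deg_varpi y).
- exact: (varpi_fin qQ deg_varpi z).
- exact: (varpi_fin qQ deg_varpi z').
Qed.

Lemma varpi_hat_sep (t : ctens Q Q) :
  (forall y z, varpi_hat varpi t y z = 0) -> t = 0.
Proof.
move=> t0; apply: functional_extensionality_dep => -[i j].
have s := @prs_separates K (Q i) (Q j) _ _
  (vform_separates qQ deg_varpi i) (vform_separates qQ deg_varpi j).
apply: s.2 => _ [_ [_ [[k [y [ijm ->]]] [l [z [ijl ->]]] ->]]].
by rewrite -(varpi_hat_hom y z t ijm ijl).
Qed.

Local Notation db i k := (dual_basis qQ deg_varpi (i := i) k).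

(** The formula is forced: once both arguments are expanded in dual bases, the defining equation
    prescribes the coefficient of each tensor of basis vectors. Each component is a finite sum,
    while infinitely many components may be nonzero. *)
Definition vartheta (b : dsum Q) : ctens Q Q := fun s =>
  \sum_(k < \dim {:Q s.1}) \sum_(l < \dim {:Q s.2})
    (- varpi b (circ (db s.1 k) (db s.2 l)) : K) *:
    ((vbasis {:Q s.1})`_k \ox (vbasis {:Q s.2})`_l).

Lemma vartheta_linear : linear vartheta.
Proof.
move=> c b b'; apply: functional_extensionality_dep => s.
rewrite -[RHS]/(c *: vartheta b s + vartheta b' s) /vartheta.
rewrite scaler_sumr -big_split; apply: eq_bigr => k _ /=.
rewrite scaler_sumr -big_split; apply: eq_bigr => l _ /=.
by rewrite (varpi_linl qQ) scalerA -scalerDl opprD mulrN.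
Qed.

Lemma is_vartheta_vartheta : is_vartheta circ varpi vartheta.
Proof.
split=> [|b y z]; first exact: vartheta_linear.
have vL : linear (varpi b) by exact: varpi_linr qQ b.
move: y; apply: (@dsum_eq _ _ K^o (fun y => _)) => [||j y].
- exact: varpi_hat_linl.
- by move=> c y y'; rewrite (circ_linl qQ) vL opprD scalerN.
move: z; apply: (@dsum_eq _ _ K^o (fun z => _)) => [||j' z].
- exact: varpi_hat_linr.
- by move=> c z z'; rewrite (circ_linr qQ) vL opprD scalerN.
have [ij ij'] : (- (j + m) + j + m = 0 /\ - (j' + m) + j' + m = 0).
  by split; rewrite -addrA addNr.
rewrite (varpi_hat_hom y z _ ij ij') /vartheta /=.
have prL : linear (pr (fun u => varpi (dinj u) (dinj y))
   (fun v => varpi (dinj v) (dinj z)) : tens (Q (- (j + m))) (Q (- (j' + m))) ->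
     K^o).
  exact: pr_form.
rewrite (lin_sum prL) [in RHS](dual_basisE qQ deg_varpi y ij).
rewrite (lin_sum (circ_linl qQ _)) (lin_sum vL) -sumrN.
apply: eq_bigr => k _; rewrite (lin_sum prL).
rewrite [in RHS](dual_basisE qQ deg_varpi z ij').
rewrite (lin_sum (circ_linr qQ _)) (lin_sum vL) -sumrN.
apply: eq_bigr => l _.
rewrite (linZ prL) (linZ (circ_linl qQ _)) (linZ (circ_linr qQ _)) !(linZ vL).
rewrite pr_pure; [|exact: (form_varpi qQ)..].
rewrite /GRing.scale /=; ring.
Qed.

(** The values of two solutions differ by a formal sum that [varpi_hat] sends to 0 on all arguments,
    and non-degeneracy makes it 0. *)
Lemma unique_vartheta : unique (is_vartheta circ varpi) vartheta.
Proof.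
split=> [|theta [thL thE]]; first exact: is_vartheta_vartheta.
apply: funext => b; apply/eqP; rewrite -subr_eq0; apply/eqP.
apply: varpi_hat_sep => y z.
have hL : linear (pair2 (varpi^~ y) (varpi^~ z) : ctens Q Q -> K^o).
  by apply: pair2_form; exact: (varpi_fin qQ deg_varpi _).
rewrite -[LHS]/((pair2 (varpi^~ y) (varpi^~ z) : ctens Q Q -> K^o) _) (linB hL).
rewrite -[pair2 _ _ (vartheta b)]/(varpi_hat varpi _ _ _) is_vartheta_vartheta.2.
by rewrite -[pair2 _ _ (theta b)]/(varpi_hat varpi _ _ _) thE subrr.
Qed.

End Copairing.

(** * Additivity of the pairings in the forms *)

Section PairingSums.
Variables (K : fieldType).

Lemma prDl (U V : vectType K) (f f' : U -> K) (g : V -> K) t :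
  pr (fun u => f u + f' u) g t = pr f g t + pr f' g t.
Proof.
rewrite -[X in X + _]mul1r -pr_linl; apply: eq_pr => // u.
by rewrite mul1r.
Qed.

Lemma prDr (U V : vectType K) (f : U -> K) (g g' : V -> K) t :
  pr f (fun u => g u + g' u) t = pr f g t + pr f g' t.
Proof.
rewrite -[X in X + _]mul1r -pr_linr; apply: eq_pr => // u.
by rewrite mul1r.
Qed.

Lemma prNl (U V : vectType K) (f : U -> K) (g : V -> K) t :
  pr (fun u => - f u) g t = - pr f g t.
Proof.
rewrite -mulN1r -[RHS]addr0 -(pr0l g t) -pr_linl; apply: eq_pr => // u.
by rewrite mulN1r addr0.
Qed.

Lemma prNr (U V : vectType K) (f : U -> K) (g : V -> K) t :
  pr f (fun u => - g u) t = - pr f g t.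
Proof.
rewrite -mulN1r -[RHS]addr0 -(pr0r f t) -pr_linr; apply: eq_pr => // u.
by rewrite mulN1r addr0.
Qed.

Lemma finformN (U : grading K) (xi : dsum U -> K) :
  finform xi -> finform (fun u => - xi u).
Proof.
move=> [xL [r r0]]; split=> [a u v|]; first by rewrite xL /GRing.scale /=; ring.
by exists r => i u ir; rewrite r0 // oppr0.
Qed.

Variables (U V : grading K).
Implicit Types (xi : dsum U -> K) (eta : dsum V -> K) (t : ctens U V).

Lemma pair2Nl xi eta t : pair2 (fun u => - xi u) eta t = - pair2 xi eta t.
Proof.
rewrite -mulN1r mulr_fsumr; apply: eq_fsbigr => ij _.
by rewrite prNl mulN1r.
Qed.

Lemma pair2Nr xi eta t : pair2 xi (fun u => - eta u) t = - pair2 xi eta t.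
Proof.
rewrite -mulN1r mulr_fsumr; apply: eq_fsbigr => ij _.
by rewrite prNr mulN1r.
Qed.

Lemma pair2Dl xi xi' eta t : finform xi -> finform xi' -> finform eta ->
  pair2 (fun u => xi u + xi' u) eta t = pair2 xi eta t + pair2 xi' eta t.
Proof.
move=> fx fx' fe; rewrite -[X in X + _]mul1r -pair2_linl //.
by apply: eq_pair2 => // u; rewrite mul1r.
Qed.

Lemma pair2Dr xi eta eta' t : finform xi -> finform eta -> finform eta' ->
  pair2 xi (fun u => eta u + eta' u) t = pair2 xi eta t + pair2 xi eta' t.
Proof.
move=> fx fe fe'; rewrite -[X in X + _]mul1r -pair2_linr //.
by apply: eq_pair2 => // u; rewrite mul1r.
Qed.

End PairingSums.

(** * Normal forms of words in four letters *)

Section LeibnizWords.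
Variables (K : fieldType) (Q : grading K).
Variables (circ : dsum Q -> dsum Q -> dsum Q) (varpi : dsum Q -> dsum Q -> K^o).

(** By the Leibniz identity the right-normed products span all products of three letters. *)
Definition word (w x y z : dsum Q) : K := varpi w (circ x (circ y z)).

(* Modulo the Leibniz identity and invariance, every multilinear expression
   varpi(u, v) in four letters is a combination of these six. *)
Definition sum6 (c1 c2 c3 c4 c5 c6 : K) (w x y z : dsum Q) : K :=
  c1 * word w x y z + c2 * word w x z y + c3 * word w y x z
  + c4 * word w y z x + c5 * word w z x y + c6 * word w z y x.

Hypothesis qQ : quadratic_graded_leibniz circ varpi.

Lemma circA x y z : circ (circ x y) z = circ x (circ y z) - circ y (circ x z).
Proof. by rewrite (qgl_leibniz qQ x y z) addrK. Qed.

Lemma varpiA v x y z :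
  varpi v (circ (circ x y) z) = word v x y z - word v y x z.
Proof. by rewrite circA (linB (varpi_linr qQ v)). Qed.

Lemma varpiDl v x y z :
  varpi v (circ (x + y) z) = varpi v (circ x z) + varpi v (circ y z).
Proof. by rewrite (linD (circ_linl qQ z)) (linD (varpi_linr qQ v)). Qed.

Lemma varpiDr v x y z :
  varpi v (circ z (x + y)) = varpi v (circ z x) + varpi v (circ z y).
Proof. by rewrite (linD (circ_linr qQ z)) (linD (varpi_linr qQ v)). Qed.

(** This lemma and the next two trade the first letter [v] for [x], one for each position of [x]
    among the other letters. In the compatibility conditions words start with either argument, and a
    common first letter is needed to compare them. *)
Lemma word_first v x y z :
  word v x y z = - word x y z v + word x z y v - word x v y z.
Proof.
rewrite /word (varpi_skew qQ) (circ_adjr qQ) (linD (varpi_linr qQ x)) varpiA /word.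
ring.
Qed.

Lemma word_second v y x z :
  word v y x z = word x z y v + word x y v z - word x v y z.
Proof.
rewrite /word (varpi_skew qQ) (circ_adjl qQ) opprK (circ_adjr qQ).
by rewrite (linD (varpi_linr qQ x)) varpiA /word addrA.
Qed.

Lemma word_third v y z x : word v y z x = - word x z y v.
Proof.
by rewrite /word (varpi_skew qQ) (circ_adjl qQ) opprK (circ_adjl qQ).
Qed.

End LeibnizWords.
(** * The axioms, tested on forms *)

Section Defects.
Variables (K : fieldType) (P : vectType K).
Variables (rhd lhd : P -> P -> P) (brhd blhd : P -> tens P P).

Local Notation ast := (fun x y => rhd x y + lhd x y).
Local Notation ominus := (fun x y => rhd x y + lhd y x).
Local Notation beta := (fun x => blhd x + brhd x).
Local Notation bominus := (fun x => tflip (blhd x) + brhd x).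
Local Notation onl f t := (tmap f (@id P) t).
Local Notation onr f t := (tmap (@id P) f t).
Local Notation cor b t := (tlift (fun u v => tcons u (b v)) t).
Local Notation col b t := (tmap b (@id P) t).
Local Notation tau12 t := (tmap (@tflip K P P) (@id P) t).

(** Here and below each axiom is recorded as the difference of its two sides, so that coefficients
    of tested identities can be linear combinations of axioms. *)
Definition alg_rr x y z : P := rhd x (rhd y z) - rhd (ast x y + ast y x) z.
Definition alg_rl x y z : P := rhd x (lhd z y) - lhd z (ast x y).
Definition alg_la x y z : P :=
  lhd z (ast x y) - (lhd (rhd x z) y + lhd (lhd z x) y).

Definition co_flip x : tens (tens P P) P :=
  cor brhd (brhd x) - tau12 (cor brhd (brhd x)).
Definition co_rr x : tens (tens P P) P :=
  cor brhd (brhd x)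
  - col (fun u => brhd u + tflip (brhd u) + blhd u + tflip (blhd u)) (brhd x).
Definition co_lb x : tens (tens P P) P :=
  cor (fun v => brhd v + blhd v) (blhd x)
  - (col blhd (blhd x) + tau12 (col brhd (blhd x))).
Definition co_lr x : tens (tens P P) P :=
  cor (fun v => brhd v + blhd v) (blhd x) - tau12 (cor blhd (brhd x)).

Definition bi_1 x y : tens P P :=
  blhd (ast x y + ast y x) - (onl (ast y) (blhd x) + onr (ominus x) (blhd y)).
Definition bi_2l x y : tens P P :=
  beta (ominus x y) - (onl (rhd x) (beta y) + onr (ominus^~ y) (brhd x)).
Definition bi_2r x y : tens P P :=
  beta (ominus x y) - (onr (ominus x) (beta y) + onl (lhd y) (blhd x)).
Definition bi_3 x y : tens P P :=
  bominus (ast x y) - (onl (rhd x) (bominus y) + onr (ast^~ y) (brhd x)).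
Definition bi_4 x y : tens P P :=
  onl (lhd y) (tflip (bominus x)) + onr (lhd^~ x) (beta y)
  - (beta (lhd y x) + tflip (beta (lhd y x))).
Definition bi_5 x y : tens P P :=
  onr (ast x) (bominus y) - onl (rhd x) (bominus y)
  - (onr (ast^~ y) (brhd x) - onl (lhd^~ y) (tflip (blhd x))).

Hypotheses (rB : is_bilinear rhd) (lB : is_bilinear lhd).
Hypotheses (brL : linear brhd) (blL : linear blhd).

Lemma zinbiel_dendriform_bialgebraP :
  zinbiel_dendriform_bialgebra rhd lhd brhd blhd <->
  [/\ forall x y z, [/\ alg_rr x y z = 0, alg_rl x y z = 0 & alg_la x y z = 0],
      forall x, [/\ co_flip x = 0, co_rr x = 0, co_lb x = 0 & co_lr x = 0],
      forall x y, [/\ bi_1 x y = 0, bi_2l x y = 0 & bi_2r x y = 0]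
    & forall x y, [/\ bi_3 x y = 0, bi_4 x y = 0 & bi_5 x y = 0]].
Proof.
have sub0 (V : zmodType) (a b : V) : (a = b) <-> (a - b = 0).
  by split=> [->|/eqP]; [rewrite subrr | rewrite subr_eq0 => /eqP].
split=> [[[_ _ a1 a2 a3] [_ _ c1 c2 c3 c4] b1 b2l b2r b3 b4 b5]|[A C B B']].
  by split=> *; split; apply: (sub0 _ _ _).1.
split; first split=> //.
- by move=> x y z; apply: (sub0 _ _ _).2; case: (A x y z).
- by move=> x y z; apply: (sub0 _ _ _).2; case: (A x y z).
- by move=> x y z; apply: (sub0 _ _ _).2; case: (A x y z).
- split=> // x.
  + by apply: (sub0 _ _ _).2; case: (C x).
  + by apply: (sub0 _ _ _).2; case: (C x).
  + by apply: (sub0 _ _ _).2; case: (C x).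
  + by apply: (sub0 _ _ _).2; case: (C x).
- by move=> x y; apply: (sub0 _ _ _).2; case: (B x y).
- by move=> x y; apply: (sub0 _ _ _).2; case: (B x y).
- by move=> x y; apply: (sub0 _ _ _).2; case: (B x y).
- by move=> x y; apply: (sub0 _ _ _).2; case: (B' x y).
- by move=> x y; apply: (sub0 _ _ _).2; case: (B' x y).
- by move=> x y; apply: (sub0 _ _ _).2; case: (B' x y).
Qed.

Implicit Types f g h : P -> K.

Lemma pr_cor f g h (b : P -> tens P P) (t : tens P P) : form f -> form g ->
  form h ->
  pr (pr f g) h (cor b t) = pr f (fun v => pr g h (b v)) t.
Proof.
move=> fL gL hL; rewrite pr_tlift.
by apply: (@eq_tlift _ _ _ K^o) => u v; rewrite pr_tcons.
Qed.

Lemma pr_tau12 f g h (t : tens (tens P P) P) : form f -> form g -> form h ->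
  pr (pr f g) h (tau12 t) = pr (pr g f) h t.
Proof.
move=> fL gL hL; rewrite pr_tmap //; last exact: pr_form.
by apply: eq_pr => // u; rewrite pr_tflip.
Qed.

Lemma pr_col f g h (b : P -> tens P P) (t : tens P P) : form h ->
  pr (pr f g) h (col b t) = pr (fun u => pr f g (b u)) h t.
Proof. by move=> hL; rewrite pr_tmap //; apply: pr_form. Qed.

Section Forms.
Variables f g h : P -> K.
Hypotheses (fL : form f) (gL : form g) (hL : form h).

Lemma pr_onl k (t : tens P P) : pr f g (onl k t) = pr (fun u => f (k u)) g t.
Proof. exact: pr_tmap. Qed.

Lemma pr_onr k (t : tens P P) : pr f g (onr k t) = pr f (fun u => g (k u)) t.
Proof. exact: pr_tmap. Qed.

Let prL := @pr_form K P P f g.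
Let pr3L := @pr_form K (tens P P) P (pr f g) h.

(** This and the following expansions write every defect in terms of [pr] applied to single
    operations, the atoms on which [ring] later compares both sides. *)
Lemma pr_co_flip x : pr (pr f g) h (co_flip x) =
  pr f (fun v => pr g h (brhd v)) (brhd x) - pr g
    (fun v => pr f h (brhd v)) (brhd x).
Proof. by rewrite (formB pr3L) pr_tau12 // !pr_cor. Qed.

Lemma pr_co_rr x : pr (pr f g) h (co_rr x) =
  pr f (fun v => pr g h (brhd v)) (brhd x)
  - (pr (fun v => pr f g (brhd v)) h (brhd x)
    + pr (fun v => pr g f (brhd v)) h (brhd x)
     + pr (fun v => pr f g (blhd v)) h (brhd x)
       + pr (fun v => pr g f (blhd v)) h (brhd x)).
Proof.
rewrite (formB pr3L) pr_cor // pr_col // -!prDl; congr (_ - _);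
  apply: eq_pr => // u.
by rewrite !(formD prL) !pr_tflip.
Qed.

Lemma pr_co_lb x : pr (pr f g) h (co_lb x) =
  pr f (fun v => pr g h (brhd v)) (blhd x)
    + pr f (fun v => pr g h (blhd v)) (blhd x)
  - (pr (fun v => pr f g (blhd v)) h (blhd x)
    + pr (fun v => pr g f (brhd v)) h (blhd x)).
Proof.
rewrite (formB pr3L) (formD pr3L) pr_tau12 // !pr_col // pr_cor // -prDr.
by congr (_ - _); apply: eq_pr => // u; rewrite (formD (pr_form g h)).
Qed.

Lemma pr_co_lr x : pr (pr f g) h (co_lr x) =
  pr f (fun v => pr g h (brhd v)) (blhd x)
    + pr f (fun v => pr g h (blhd v)) (blhd x)
  - pr g (fun v => pr f h (blhd v)) (brhd x).
Proof.
rewrite (formB pr3L) pr_tau12 // !pr_cor // -prDr.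
by congr (_ - _); apply: eq_pr => // u; rewrite (formD (pr_form g h)).
Qed.

Let rrl a : form (fun u => f (rhd a u)).
Proof. by move=> c u v; rewrite rB.2 fL. Qed.
Let lll a : form (fun u => f (lhd a u)).
Proof. by move=> c u v; rewrite lB.2 fL. Qed.
Let llr a : form (fun u => f (lhd u a)).
Proof. by move=> c u v; rewrite lB.1 fL. Qed.
Let rrl' a : form (fun u => g (rhd a u)).
Proof. by move=> c u v; rewrite rB.2 gL. Qed.
Let lll' a : form (fun u => g (lhd a u)).
Proof. by move=> c u v; rewrite lB.2 gL. Qed.

Lemma pr_funDl (k k' : P -> P) t :
  pr (fun u => f (k u + k' u)) g t
  = pr (fun u => f (k u)) g t + pr (fun u => f (k' u)) g t.
Proof. by rewrite -prDl; apply: eq_pr => // u; rewrite (formD fL). Qed.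

Lemma pr_funDr (k k' : P -> P) t :
  pr f (fun u => g (k u + k' u)) t
  = pr f (fun u => g (k u)) t + pr f (fun u => g (k' u)) t.
Proof. by rewrite -prDr; apply: eq_pr => // u; rewrite (formD gL). Qed.

(** In the bialgebra defects, operators become precompositions of the forms and a flip becomes an
    exchange of the two forms. *)
Lemma pr_bi_1 x y : pr f g (bi_1 x y) =
  pr f g (blhd (rhd x y)) + pr f g (blhd (lhd x y))
  + pr f g (blhd (rhd y x)) + pr f g (blhd (lhd y x))
  - (pr (fun u => f (rhd y u)) g (blhd x) + pr (fun u => f (lhd y u)) g (blhd x)
     + (pr f (fun u => g (rhd x u)) (blhd y)
       + pr f (fun u => g (lhd u x)) (blhd y))).
Proof.
rewrite (formB prL) !(formD prL) pr_onl pr_onr pr_funDl pr_funDr.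
by rewrite !(linD blL) !(formD prL) !addrA.
Qed.

Lemma pr_bi_2l x y : pr f g (bi_2l x y) =
  pr f g (blhd (rhd x y)) + pr f g (blhd (lhd y x))
  + pr f g (brhd (rhd x y)) + pr f g (brhd (lhd y x))
  - (pr (fun u => f (rhd x u)) g (blhd y) + pr (fun u => f (rhd x u)) g (brhd y)
     + (pr f (fun u => g (rhd u y)) (brhd x)
       + pr f (fun u => g (lhd y u)) (brhd x))).
Proof.
rewrite (formB prL) !(formD prL) pr_onl pr_onr pr_funDr (formD (pr_form _ _)).
by rewrite !(linD blL) !(linD brL) !(formD prL) !addrA.
Qed.

Lemma pr_bi_2r x y : pr f g (bi_2r x y) =
  pr f g (blhd (rhd x y)) + pr f g (blhd (lhd y x))
  + pr f g (brhd (rhd x y)) + pr f g (brhd (lhd y x))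
  - (pr f (fun u => g (rhd x u)) (blhd y) + pr f (fun u => g (lhd u x)) (blhd y)
     + (pr f (fun u => g (rhd x u)) (brhd y) + pr f (fun u => g (lhd u x)) (brhd y))
     + pr (fun u => f (lhd y u)) g (blhd x)).
Proof.
rewrite (formB prL) !(formD prL) pr_onl pr_onr (formD (pr_form _ _)) !pr_funDr.
by rewrite !(linD blL) !(linD brL) !(formD prL) !addrA.
Qed.

Lemma pr_bi_3 x y : pr f g (bi_3 x y) =
  pr g f (blhd (rhd x y)) + pr g f (blhd (lhd x y))
  + pr f g (brhd (rhd x y)) + pr f g (brhd (lhd x y))
  - (pr g (fun u => f (rhd x u)) (blhd y) + pr (fun u => f (rhd x u)) g (brhd y)
     + (pr f (fun u => g (rhd u y)) (brhd x)
       + pr f (fun u => g (lhd u y)) (brhd x))).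
Proof.
rewrite (formB prL) !(formD prL) pr_onl pr_onr (formD (pr_form _ _)) !pr_funDr.
by rewrite !pr_tflip // !(linD blL) !(linD brL) !(formD (pr_form _ _)) !addrA.
Qed.

Lemma pr_bi_4 x y : pr f g (bi_4 x y) =
  pr (fun u => f (lhd y u)) g (blhd x) + pr g (fun u => f (lhd y u)) (brhd x)
  + (pr f (fun u => g (lhd u x)) (blhd y) + pr f (fun u => g (lhd u x)) (brhd y))
  - (pr f g (blhd (lhd y x)) + pr f g (brhd (lhd y x))
     + (pr g f (blhd (lhd y x)) + pr g f (brhd (lhd y x)))).
Proof.
rewrite (formB prL) !(formD prL) pr_onl pr_onr !pr_tflip //.
by rewrite !(formD (pr_form _ _)) pr_tflip.
Qed.

Lemma pr_bi_5 x y : pr f g (bi_5 x y) =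
  (pr (fun u => g (rhd x u)) f (blhd y) + pr (fun u => g (lhd x u)) f (blhd y))
  + (pr f (fun u => g (rhd x u)) (brhd y) + pr f (fun u => g (lhd x u)) (brhd y))
  - (pr g (fun u => f (rhd x u)) (blhd y) + pr (fun u => f (rhd x u)) g (brhd y))
  - (pr f (fun u => g (rhd u y)) (brhd x) + pr f (fun u => g (lhd u y)) (brhd x)
     - pr g (fun u => f (lhd u y)) (blhd x)).
Proof.
have gxL : form (fun u => g (rhd x u + lhd x u)).
  by move=> c u v; rewrite !(formD gL) rrl' lll' /GRing.scale /=; ring.
rewrite !(formB prL) !pr_onl !pr_onr !(formD (pr_form _ _)) !pr_tflip //.
rewrite !pr_funDr -prDl; do 3 congr (_ + _).
by apply: eq_pr => // u; rewrite (formD gL).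
Qed.

End Forms.
End Defects.

Lemma tens_eq (K : fieldType) (U V : vectType K) (X : lmodType K)
    (h h' : tens U V -> X) : linear h -> linear h' ->
  (forall u v, h (u \ox v) = h' (u \ox v)) -> h =1 h'.
Proof.
move=> hL h'L hh' t; rewrite -(tlift_unique t hL) -(tlift_unique t h'L).
exact: eq_tlift.
Qed.

(** * The operations on P (x) Q, tested on forms *)

Section TensorPreLie.
Variables (K : fieldType) (P : vectType K) (Q : grading K).
Variables (circ : dsum Q -> dsum Q -> dsum Q) (varpi : dsum Q -> dsum Q -> K^o).
Hypothesis qQ : quadratic_graded_leibniz circ varpi.
Variable m : int.
Hypothesis deg_varpi : forall (i j : int) (x : Q i) (y : Q j),
  i + j + m != 0 -> varpi (dinj x) (dinj y) = 0.
Variable theta : dsum Q -> ctens Q Q.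
Hypothesis thetaP : is_vartheta circ varpi theta.
Variables (rhd lhd : P -> P -> P) (brhd blhd : P -> tens P P).
Hypotheses (rB : is_bilinear rhd) (lB : is_bilinear lhd).
Hypotheses (brL : linear brhd) (blL : linear blhd).

Local Notation L := (gtens P Q).
Local Notation dot := (PQ_dot rhd lhd circ).
Local Notation delta := (PQ_delta brhd blhd theta).
Local Notation Br f g := (fun a => pr f g (brhd a)).
Local Notation Bl f g := (fun a => pr f g (blhd a)).

(* The form a (x) x |-> f(a) varpi(x, y) on P (x) Q.  Those with y homogeneous
   separate points, and so do their products on completed tensor products. *)
Definition tf (f : P -> K) (y : dsum Q) : dsum L -> K :=
  glift (fun a x => f a * varpi x y : K^o).

Lemma tf_form f y : form (tf f y).
Proof. exact: glift_linear. Qed.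

Lemma tf_pure f y a x : form f -> tf f y (gpure a x) = f a * varpi x y.
Proof.
move=> fL; apply: (@glift_pure _ _ _ K^o) => {a x}; split=> [x|a] c u v /=.
  by rewrite fL mulrDl -mulrA.
by rewrite (varpi_linl qQ) mulrDr mulrCA.
Qed.

Lemma tf_dinj_form f y i : form (fun u : L i => tf f y (dinj u)).
Proof. by move=> c u v; rewrite dinj_linear tf_form. Qed.

Lemma tf_fin f y : form f -> finform (tf f y).
Proof.
move=> fL; split; first exact: tf_form.
have [_ [r r0]] := varpi_fin qQ deg_varpi y; exists r => i u ir; move: u.
apply: (@tens_eq _ _ _ K^o _ (fun=> 0)) => [||a x]; first exact: tf_dinj_form.
  by move=> c u v; rewrite scaler0 addr0.
by rewrite -gpure_dinj tf_pure // r0 // mulr0.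
Qed.

(** For [y] homogeneous, the form sees only the component in the complementary degree; there it is a
    product form on a finite-dimensional tensor product. *)
Lemma tf_hom f j (y : Q j) i u : form f -> i + j + m = 0 ->
  tf f (dinj y) u = pr f (fun x => varpi (dinj x) (dinj y)) (u i).
Proof.
move=> fL ijm; have vL : form (fun x : Q i => varpi (dinj x) (dinj y)).
  exact: (form_varpi qQ).
move: u; apply: (@gtens_eq _ _ _ K^o) => [||a k x].
- exact: tf_form.
- by move=> c u v; rewrite pr_form.
rewrite tf_pure // -[gpure a _ i]/(a \ox (dinj x i)) pr_pure //; congr (_ * _).
have [ki|ki] := eqVneq i k; first by subst i; rewrite dinj_same.
rewrite dinj_out // (lin0 (@dinj_linear _ _ _)) (lin0 (varpi_linl qQ _)).
apply: deg_varpi; apply: contra_neq ki => ki.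
by apply/(addIr j)/(addIr m); rewrite ki.
Qed.

Lemma tf_sep u :
  (forall f j (y : Q j), form f -> tf f (dinj y) u = 0) -> u = 0.
Proof.
move=> u0; apply: dsum_ext => i; rewrite -[RHS]/(0 : tens P (Q i)).
apply: (prs_separates (form_separates P) (vform_separates qQ deg_varpi i)).2.
by move=> _ [f [_ [fL [j [y [ijm ->]]] ->]]]; rewrite -tf_hom ?u0.
Qed.

Lemma pair2_tf f g j j' (y : Q j) (z : Q j') i i' (t : ctens L L) :
  form f -> form g -> i + j + m = 0 -> i' + j' + m = 0 ->
  pair2 (tf f (dinj y)) (tf g (dinj z)) t =
  pr (pr f (fun x => varpi (dinj x) (dinj y)))
     (pr g (fun x => varpi (dinj x) (dinj z))) (t (i, i')).
Proof.
move=> fL gL ij ij'; rewrite (@pair2_hom _ _ _ _ _ i i').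
- by apply: eq_pr => u; rewrite (tf_hom _ _ fL ij, tf_hom _ _ gL ij') dinj_same.
- move=> k u ki; rewrite (tf_hom _ _ fL ij) dinj_out 1?eq_sym //.
  exact: (form0 (pr_form _ _)).
- move=> k u ki; rewrite (tf_hom _ _ gL ij') dinj_out 1?eq_sym //.
  exact: (form0 (pr_form _ _)).
Qed.

Lemma tf_sep2 (t : ctens L L) :
  (forall f g j j' (y : Q j) (z : Q j'), form f -> form g ->
     pair2 (tf f (dinj y)) (tf g (dinj z)) t = 0) -> t = 0.
Proof.
move=> t0; apply: functional_extensionality_dep => -[i j].
rewrite -[RHS]/(0 : tens (tens P (Q i)) (tens P (Q j))).
apply: (prs_separates
  (prs_separates (form_separates P) (vform_separates qQ deg_varpi i))
  (prs_separates (form_separates P) (vform_separates qQ deg_varpi j))).2.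
move=> _ [_ [_ [[f [_ [fL [k [y [ij ->]]] ->]]] [g [_ [gL [l [z [ij' ->]]] ->]]]
  ->]]].
by rewrite -pair2_tf ?t0.
Qed.

Lemma degE j : - (j + m) + j + m = 0.
Proof. by rewrite -addrA addNr. Qed.

Lemma pair2_cmap f g j j' (y : Q j) (z : Q j') (F G : dsum L -> dsum L)
    (t : ctens L L) : form f -> form g -> cont F -> cont G ->
  pair2 (tf f (dinj y)) (tf g (dinj z)) (cmap F G t) =
  pair2 (fun u => tf f (dinj y) (F u)) (fun v => tf g (dinj z) (G v)) t.
Proof.
move=> fL gL Fc Gc; rewrite (pair2_tf _ _ _ fL gL (degE j) (degE j')).
rewrite pr_cmap //; try exact: pr_form.
by apply: eq_pair2 => u; rewrite (tf_hom _ _ fL (degE _), tf_hom _ _ gL (degE _)).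
Qed.

Lemma pair2_bullet f g y z p q : form f -> form g ->
  pair2 (tf f y) (tf g z) (bullet p q : ctens L L) =
    pr f g p * varpi_hat varpi q y z.
Proof.
move=> fL gL; rewrite /varpi_hat mulr_fsumr; apply: eq_fsbigr => -[i j] _.
set F := fun u : L i => tf f y (dinj u); set G := fun u : L j => tf g z (dinj u).
have [FL GL] : form F /\ form G by split; apply: tf_dinj_form.
rewrite pr_tlift mulrC.
(* A scalar factor enters a [tlift] as the linear map multiplying by it: here the factor from [q],
   below the one from [p]. *)
have mL : linear (fun x : K^o => pr (fun x1 : Q i => varpi (dinj x1) y)
  (fun x2 : Q j => varpi (dinj x2) z) (q (i, j)) * x : K^o).
  by move=> c u v; rewrite mulrDr mulrCA.
apply: (etrans _ (esym (lin_tlift _ p mL))); apply: (@eq_tlift _ _ _ K^o) => a1 a2.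
have m'L : linear (fun x : K^o => f a1 * g a2 * x : K^o).
  by move=> c u v; rewrite mulrDr mulrCA.
rewrite mulrC pr_tlift; apply: (etrans _ (esym (lin_tlift _ _ m'L))).
apply: (@eq_tlift _ _ _ K^o) => x1 x2.
by rewrite pr_pure // /F /G -!gpure_dinj !tf_pure // mulrACA.
Qed.

(** * The coproduct on P (x) Q and its transpose *)

Lemma delta_linear : linear delta.
Proof. exact: glift_linear. Qed.

Lemma bullet_linl (q : ctens Q Q) : linear (fun p : tens P P => bullet p q).
Proof.
by move=> c p p'; apply: functional_extensionality_dep => s; apply: tlift_linear.
Qed.

Lemma bullet_linr (p : tens P P) : linear (bullet p : ctens Q Q -> _).
Proof.
move=> c q q'; apply: functional_extensionality_dep => s.
rewrite -[RHS]/(c *: bullet p q s + bullet p q' s) -tlift_funD.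
by apply: eq_tlift => a1 a2; rewrite -tlift_linear.
Qed.

Lemma cflip_linear (U V : grading K) : linear (@cflip K U V).
Proof.
by move=> c t t'; apply: functional_extensionality_dep => s; apply: tlift_linear.
Qed.

Lemma delta_pure a x : delta (gpure a x) =
  bullet (brhd a) (theta x) - bullet (tflip (blhd a)) (cflip (theta x)).
Proof.
apply: glift_pure => {a x}; split=> [x|a] c u v /=.
  rewrite brL blL tflip_linear !(bullet_linl _ c).
  by rewrite scalerBr opprD addrACA.
rewrite thetaP.1 cflip_linear !(bullet_linr _ c).
by rewrite scalerBr opprD addrACA.
Qed.

(** In the second term the flips act on both tensor factors, so forms and letters are exchanged
    together. The identities below see the values of [delta] through this formula. *)
Lemma pair2_delta f g y z u : form f -> form g ->
  pair2 (tf f y) (tf g z) (delta u) =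
  - tf (Br f g) (circ y z) u + tf (Bl g f) (circ z y) u.
Proof.
move=> fL gL; move: u.
have PL : linear (pair2 (tf f y) (tf g z) : ctens L L -> K^o).
  by apply: pair2_form; apply: tf_fin.
have BrL : form (Br f g) by move=> c a b; rewrite brL pr_form.
have BlL : form (Bl g f) by move=> c a b; rewrite blL pr_form.
apply: (@gtens_eq _ _ _ K^o) => [||a i x].
- exact: lin_comp PL delta_linear.
- by move=> c u v; rewrite !tf_form /GRing.scale /=; ring.
rewrite delta_pure (linB PL) !pair2_bullet // thetaP.2 pr_tflip //.
rewrite -[varpi_hat _ _ _ _]/(pair2 (varpi^~ y) (varpi^~ z) _).
rewrite pair2_cflip; try exact: (varpi_linl qQ).
rewrite -[pair2 _ _ _]/(varpi_hat varpi _ _ _) thetaP.2 !tf_pure //; ring.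
Qed.

Lemma Br_form f g : form (Br f g).
Proof. by move=> c a b; rewrite brL pr_form. Qed.

Lemma Bl_form f g : form (Bl f g).
Proof. by move=> c a b; rewrite blL pr_form. Qed.

Lemma comp_rhdl f a : form f -> form (fun b => f (rhd a b)).
Proof. by move=> fL c u v; rewrite rB.2 fL. Qed.

Lemma comp_rhdr f a : form f -> form (fun b => f (rhd b a)).
Proof. by move=> fL c u v; rewrite rB.1 fL. Qed.

Lemma comp_lhdl f a : form f -> form (fun b => f (lhd a b)).
Proof. by move=> fL c u v; rewrite lB.2 fL. Qed.

Lemma comp_lhdr f a : form f -> form (fun b => f (lhd b a)).
Proof. by move=> fL c u v; rewrite lB.1 fL. Qed.

(** * The product on P (x) Q: bilinearity, degrees and transposes *)

Lemma dot_inner_bilinear a x : is_bilinear (fun b y =>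
  gpure (rhd a b) (circ x y) - gpure (lhd b a) (circ y x)).
Proof.
split=> [y|b] c u v /=.
  by rewrite rB.2 lB.1 !(gpure_linl _ c) scalerBr opprD addrACA.
by rewrite (circ_linr qQ) (circ_linl qQ) !(gpure_linr _ c) scalerBr opprD addrACA.
Qed.

Lemma dot_linr u : linear (dot u).
Proof.
move=> c v w; rewrite /PQ_dot -glift_funlin; apply: eq_glift => a x.
exact: glift_linear.
Qed.

Lemma dot_linl v : linear (dot^~ v).
Proof. exact: glift_linear. Qed.

Lemma dot_pure a x b y : dot (gpure a x) (gpure b y) =
  gpure (rhd a b) (circ x y) - gpure (lhd b a) (circ y x).
Proof.
rewrite /PQ_dot glift_pure; first exact: (glift_pure _ _ (dot_inner_bilinear a x)).
split=> {a x} [x|a] c u v /=; rewrite -glift_funlin; apply: eq_glift => b' y'.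
  by rewrite rB.1 lB.2 !(gpure_linl _ c) scalerBr opprD addrACA.
by rewrite (circ_linr qQ) (circ_linl qQ) !(gpure_linr _ c) scalerBr opprD addrACA.
Qed.

Lemma dot_dinj_out a i (x : Q i) j (v : L j) k : k != i + j ->
  dot (gpure a (dinj x)) (dinj v) k = 0 /\ dot (dinj v) (gpure a (dinj x)) k = 0.
Proof.
move=> kij; have kji : k != j + i by rewrite addrC.
split; move: v; apply: (@tens_eq _ _ _ _ _ (fun=> 0)) => [||b y];
  try by move=> c u v; rewrite ?scaler0 ?addr0 // dinj_linear ?dot_linr ?dot_linl.
- rewrite -gpure_dinj dot_pure -[LHS]/(rhd a b \ox circ _ _ k - lhd b a \ox circ
  _ _ k).
  by rewrite !(circ_deg qQ) // !pure0r subr0.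
- rewrite -gpure_dinj dot_pure -[LHS]/(rhd b a \ox circ _ _ k - lhd a b \ox circ
  _ _ k).
  by rewrite !(circ_deg qQ) // !pure0r subr0.
Qed.

(** A homogeneous pure tensor of degree [i] sends only degree [j - i] to degree [j]; finite
    combinations of such maps keep the finiteness. *)
Lemma cont_dotl u : cont (dot u).
Proof.
move: u; apply: gtens_ind => [|c u v uc vc|a i x].
- split; first exact: dot_linr.
  by move=> j; exists [::] => i v _; rewrite (lin0 (dot_linl _)).
- rewrite (_ : dot _ = fun w => c *: dot u w + dot v w); first exact: cont_lin.
  by apply: funext => w; rewrite dot_linl.
split=> [|j]; first exact: dot_linr.
exists [:: j - i] => k v; rewrite inE => kji.
by apply: (dot_dinj_out a x v _).1; rewrite addrC -subr_eq eq_sym.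
Qed.

Lemma cont_dotr u : cont (dot^~ u).
Proof.
move: u; apply: gtens_ind => [|c u v uc vc|a i x].
- split; first exact: dot_linl.
  by move=> j; exists [::] => i v _; rewrite (lin0 (dot_linr _)).
- rewrite (_ : dot^~ _ = fun w => c *: dot w u + dot w v); first exact: cont_lin.
  by apply: funext => w; rewrite dot_linr.
split=> [|j]; first exact: dot_linl.
exists [:: j - i] => k v; rewrite inE => kji.
by apply: (dot_dinj_out a x v _).2; rewrite addrC -subr_eq eq_sym.
Qed.

(** The term with [rhd] multiplies by [w] on the left in [Q], the term with [lhd] on the right, so
    the two adjoints of [circ] give the two terms. *)
Lemma tf_dotl f y a w v : form f ->
  tf f y (dot (gpure a w) v) =
  - tf (fun b => f (rhd a b)) (circ w y) v
  - tf (fun b => f (lhd b a)) (circ w y + circ y w) v.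
Proof.
move=> fL; move: v; apply: (@gtens_eq _ _ _ K^o) => [||b i x].
- exact: lin_comp (@tf_form f y) (dot_linr _).
- by move=> c u v; rewrite !tf_form /GRing.scale /=; ring.
rewrite dot_pure (formB (@tf_form f y)) !tf_pure //; last 2 first.
- exact: comp_lhdr.
- exact: comp_rhdl.
by rewrite (circ_adjl qQ) (circ_adjr qQ) mulrN.
Qed.

Lemma tf_dotr f y a w v : form f ->
  tf f y (dot v (gpure a w)) =
  tf (fun b => f (rhd b a)) (circ w y + circ y w) v
  + tf (fun b => f (lhd a b)) (circ w y) v.
Proof.
move=> fL; move: v; apply: (@gtens_eq _ _ _ K^o) => [||b i x].
- exact: lin_comp (@tf_form f y) (dot_linl _).
- by move=> c u v; rewrite !tf_form /GRing.scale /=; ring.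
rewrite dot_pure (formB (@tf_form f y)) !tf_pure //; last 2 first.
- exact: comp_lhdl.
- exact: comp_rhdr.
by rewrite (circ_adjr qQ w (dinj x)) (circ_adjl qQ w) mulrN opprK.
Qed.

(** [delta] lowers the total degree by [m]: its test against degrees [j] and [j'] involves [varpi]
    between degrees [i] and [j + j']. This makes the iterated composites of [delta] finite in each
    component. *)
Lemma delta_out i (u : L i) s : i != s.1 + s.2 + m -> delta (dinj u) s = 0.
Proof.
case: s => k l /= ikl; move: u.
apply: (@tens_eq _ _ _ (tens (tens P (Q k)) (tens P (Q l))) _ (fun=> 0)) => [||a x].
- by move=> c u v; rewrite dinj_linear delta_linear.
- by move=> c u v; rewrite scaler0 addr0.
apply: (prs_separates
  (prs_separates (form_separates P) (vform_separates qQ deg_varpi k))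
  (prs_separates (form_separates P) (vform_separates qQ deg_varpi l))).2.
move=> _ [_ [_ [[f [_ [fL [j [y [kj ->]]] ->]]] [g [_ [gL [j' [z [lj ->]]] ->]]]
  ->]]].
rewrite -pair2_tf // -gpure_dinj pair2_delta // !tf_pure;
  do ?[exact: Br_form | exact: Bl_form].
have ij : i + (j + j') + m != 0.
  apply: contra_neq ikl => ij; apply/(addIr (j + j'))/(addIr m); rewrite ij.
  have -> : k + l + m + (j + j') + m = (k + j + m) + (l + j' + m) by ring.
  by rewrite kj lj addr0.
rewrite !(varpi_circ_deg qQ deg_varpi) ?mulr0 ?addr0 ?oppr0 //.
by rewrite [j' + j]addrC.
Qed.

(** * The pre-Lie identity of the product, tested *)

Local Notation w := (word circ varpi).
Local Notation s6 := (sum6 circ varpi).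
Local Notation rr := (alg_rr rhd lhd).
Local Notation rl := (alg_rl rhd lhd).
Local Notation la := (alg_la rhd lhd).

Lemma dotBl u v v' : dot (u - v) v' = dot u v' - dot v v'.
Proof. exact: (linB (dot_linl v')). Qed.
Lemma dotBr u v v' : dot u (v - v') = dot u v - dot u v'.
Proof. exact: (linB (dot_linr u)). Qed.
Lemma rhdDl a b c : rhd (a + b) c = rhd a c + rhd b c.
Proof. exact: (linD (rB.1 c)). Qed.
Lemma lhdDr a b c : lhd c (a + b) = lhd c a + lhd c b.
Proof. exact: (linD (lB.2 c)). Qed.

Definition assoc4 (u v t : dsum L) : dsum L :=
  dot (dot u v) t - dot u (dot v t) - (dot (dot v u) t - dot v (dot u t)).

Lemma varpi_word v x y z : varpi (circ x (circ y z)) v = - w v x y z.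
Proof. by rewrite (varpi_skew qQ). Qed.

Lemma varpi_wordA v x y z : varpi (circ (circ x y) z) v = w v y x z - w v x y z.
Proof. by rewrite (varpi_skew qQ) (varpiA qQ) opprB. Qed.

(** The first, fifth and second coefficients are triangular in the three algebra axioms. By
    antisymmetry in the first two arguments, the third, sixth and fourth are their negatives with
    [a] and [b] exchanged. *)
Lemma tf_assoc f a b c q x y z : form f ->
  tf f q (assoc4 (gpure a x) (gpure b y) (gpure c z)) =
  s6 (f (rr a b c)) (- f (rl a b c) - f (la a b c)) (- f (rr b a c))
     (f (rl b a c) + f (la b a c)) (f (la a b c)) (- f (la b a c)) q x y z.
Proof.
move=> fL; have tL := @tf_form f q; rewrite /assoc4.
rewrite !dot_pure !dotBl !dotBr !dot_pure !(formB tL) !tf_pure //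
  !varpi_word !varpi_wordA.
rewrite /alg_rr /alg_rl /alg_la /sum6 !rhdDl !lhdDr !(formB fL) !(formD fL).
ring.
Qed.

(** * Threefold tests and the pre-Lie coalgebra identity *)

Implicit Types f g h : P -> K.

(** With homogeneous letters, the product of three test forms lives on one component of the
    threefold product, so that component alone is read. *)
Definition test3 f j (y : Q j) g k (z : Q k) h l (t : Q l) (X : ctens3 L L L) : K :=
  pr (pr (pr f (fun x : Q (- (j + m)) => varpi (dinj x) (dinj y)))
         (pr g (fun x : Q (- (k + m)) => varpi (dinj x) (dinj z))))
     (pr h (fun x : Q (- (l + m)) => varpi (dinj x) (dinj t)))
     (X (- (j + m), - (k + m), - (l + m))).

Lemma test3_form f j (y : Q j) g k (z : Q k) h l (t : Q l) :
  linear (test3 f y g z h t : ctens3 L L L -> K^o).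
Proof. by move=> c X Y; rewrite /test3 -[RHS]pr_form. Qed.

Lemma prv_form f i j (y : Q j) :
  form (pr f (fun x : Q i => varpi (dinj x) (dinj y))).
Proof. exact: pr_form. Qed.

Lemma test3_cflip12 f j (y : Q j) g k (z : Q k) h l (t : Q l) X :
  test3 f y g z h t (cflip12 X) = test3 g z f y h t X.
Proof.
rewrite /test3 /cflip12 /= pr_tmap; [|exact: pr_form|exact: pr_form].
by apply: eq_pr => // u; rewrite pr_tflip //; apply: prv_form.
Qed.

Lemma test3_sep (X : ctens3 L L L) :
  (forall f g h j k l (y : Q j) (z : Q k) (t : Q l), form f -> form g -> form h ->
     test3 f y g z h t X = 0) -> X = 0.
Proof.
move=> X0; apply: functional_extensionality_dep => -[[i i'] i''].
rewrite -[RHS]/(0 : tens (tens (tens P (Q i)) (tens P (Q i'))) (tens P (Q i''))).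
have s k := prs_separates (form_separates P) (vform_separates qQ deg_varpi k).
apply: (prs_separates (prs_separates (s i) (s i')) (s i'')).2.
move=> _ [_ [_ [[_ [_ [[f [_ [fL [j [y [ij ->]]] ->]]]
  [g [_ [gL [k [z [ik ->]]] ->]]] ->]]] [h [_ [hL [l [t [il ->]]] ->]]] ->]]].
have negE a b : a + b + m = 0 -> a = - (b + m).
  by move=> ab; apply/eqP; rewrite -addr_eq0 addrA ab.
move: (negE _ _ ij) (negE _ _ ik) (negE _ _ il) => ? ? ?; subst i i' i''.
exact: (X0 f g h j k l y z t).
Qed.

(** The first factor must have degree [s.1.1], and by homogeneity of [delta] the second must have
    degree [s.1.2 + s.2 + m]; a single pair of degrees contributes. *)
Lemma id_delta_out s (ij : int * int) (u : L ij.1) (v : L ij.2) :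
  ij \notin [:: (s.1.1, s.1.2 + s.2 + m)] -> id_delta delta (dinj u) (dinj v) s = 0.
Proof.
case: s ij u v => [[k1 k2] k3] [i i'] u v.
rewrite inE xpair_eqE negb_and => /orP[ik|jk]; rewrite /id_delta.
  rewrite [X in tcons X](dinj_out u) 1?eq_sym //.
  rewrite -[RHS](tlift_fun0 _ (delta (dinj v) (k2, k3))).
  by apply: eq_tlift => a b; rewrite !pure0l.
by rewrite [X in tcons _ X]delta_out //; exact: (lin0 (@tlift_linear _ _ _ _ _)).
Qed.

Lemma delta_id_out s (ij : int * int) (u : L ij.1) (v : L ij.2) :
  ij \notin [:: (s.1.1 + s.1.2 + m, s.2)] -> delta_id delta (dinj u) (dinj v) s = 0.
Proof.
case: s ij u v => [[k1 k2] k3] [i i'] u v.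
rewrite inE xpair_eqE negb_and => /orP[ik|jk]; rewrite /delta_id.
  by rewrite [X in X \ox _]delta_out // pure0l.
by rewrite [X in _ \ox X](dinj_out v) 1?eq_sym // pure0r.
Qed.

Lemma id_delta_defined t : cext_defined (id_delta delta) t.
Proof.
move=> s; apply: (@finite_supp _ _ (cterm (id_delta delta) t s)) => ij.
exact: (cterm0 (@id_delta_out s)).
Qed.

Lemma delta_id_defined t : cext_defined (delta_id delta) t.
Proof.
move=> s; apply: (@finite_supp _ _ (cterm (delta_id delta) t s)) => ij.
exact: (cterm0 (@delta_id_out s)).
Qed.

Lemma test3_id_delta f j (y : Q j) g k (z : Q k) h l (t : Q l) T :
  form f -> form g -> form h ->
  test3 f y g z h t (cext (id_delta delta) T) =
  pair2 (tf f (dinj y)) (fun v => pair2 (tf g (dinj z)) (tf h (dinj t))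
    (delta v)) T.
Proof.
move=> fL gL hL; rewrite /test3.
rewrite (cext_form (@id_delta_out (- (j + m), - (k + m), - (l + m))));
  last exact: pr_form.
apply: eq_fsbigr => ij _; apply: (@eq_tlift _ _ _ K^o) => u v.
rewrite pr_tcons; [|exact: prv_form..].
by rewrite (tf_hom _ _ fL (degE j)) (pair2_tf _ _ _ gL hL (degE k) (degE l)).
Qed.

Lemma test3_delta_id f j (y : Q j) g k (z : Q k) h l (t : Q l) T :
  form f -> form g -> form h ->
  test3 f y g z h t (cext (delta_id delta) T) =
  pair2 (fun v => pair2 (tf f (dinj y)) (tf g (dinj z)) (delta v))
    (tf h (dinj t)) T.
Proof.
move=> fL gL hL; rewrite /test3.
rewrite (cext_form (@delta_id_out (- (j + m), - (k + m), - (l + m))));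
  last exact: pr_form.
apply: eq_fsbigr => ij _; apply: (@eq_tlift _ _ _ K^o) => u v.
rewrite pr_pure; [|exact: pr_form..].
by rewrite (tf_hom _ _ hL (degE l)) (pair2_tf _ _ _ fL gL (degE j) (degE k)).
Qed.

(** The outcome of [pair2_delta] applied to the inner and then to the outer occurrence of
    [delta]. *)
Definition id_delta_val f y g z h t u : K :=
  tf (Br f (Br g h)) (circ y (circ z t)) u
  - tf (Bl (Br g h) f) (circ (circ z t) y) u
  - tf (Br f (Bl h g)) (circ y (circ t z)) u
  + tf (Bl (Bl h g) f) (circ (circ t z) y) u.

Definition delta_id_val f y g z h t u : K :=
  tf (Br (Br f g) h) (circ (circ y z) t) u
  - tf (Bl h (Br f g)) (circ t (circ y z)) u
  - tf (Br (Bl g f) h) (circ (circ z y) t) u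
  + tf (Bl h (Bl g f)) (circ t (circ z y)) u.

Lemma pair2_id_delta f y g z h t u : form f -> form g -> form h ->
  pair2 (tf f y) (fun v => pair2 (tf g z) (tf h t) (delta v)) (delta u) =
  id_delta_val f y g z h t u.
Proof.
move=> fL gL hL; have [BrL BlL] := (Br_form g h, Bl_form h g).
apply: (etrans (eq_pair2 _ (fun=> erefl) (fun v => pair2_delta z t v gL hL))).
rewrite pair2Dr ?pair2Nr; do ?[exact: tf_fin | apply: finformN; exact: tf_fin].
by rewrite !pair2_delta // opprD opprK addrA.
Qed.

Lemma pair2_delta_id f y g z h t u : form f -> form g -> form h ->
  pair2 (fun v => pair2 (tf f y) (tf g z) (delta v)) (tf h t) (delta u) =
  delta_id_val f y g z h t u.
Proof.
move=> fL gL hL; have [BrL BlL] := (Br_form f g, Bl_form g f).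
apply: (etrans (eq_pair2 _ (fun v => pair2_delta y z v fL gL) (fun=> erefl))).
rewrite pair2Dl ?pair2Nl; do ?[exact: tf_fin | apply: finformN; exact: tf_fin].
by rewrite !pair2_delta // opprD opprK addrA.
Qed.

Definition coassoc4 (u : dsum L) : ctens3 L L L :=
  cext (id_delta delta) (delta u) - cflip12 (cext (id_delta delta) (delta u))
  - (cext (delta_id delta) (delta u) - cflip12 (cext (delta_id delta) (delta u))).

Lemma test3_coassoc4 f j (y : Q j) g k (z : Q k) h l (t : Q l) u :
  form f -> form g -> form h ->
  test3 f y g z h t (coassoc4 u) =
  id_delta_val f (dinj y) g (dinj z) h (dinj t) u
  - id_delta_val g (dinj z) f (dinj y) h (dinj t) u
  - (delta_id_val f (dinj y) g (dinj z) h (dinj t) u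
     - delta_id_val g (dinj z) f (dinj y) h (dinj t) u).
Proof.
move=> fL gL hL; have tB := linB (test3_form f y g z h t).
rewrite /coassoc4 !tB; congr (_ - _ - (_ - _)).
- exact: etrans (test3_id_delta _ _ _ _ fL gL hL) (pair2_id_delta _ _ _ _ fL gL hL).
- apply: etrans (test3_cflip12 _ _ _ _ _ _ _) _.
  exact: etrans (test3_id_delta _ _ _ _ gL fL hL) (pair2_id_delta _ _ _ _ gL fL hL).
- exact: etrans (test3_delta_id _ _ _ _ fL gL hL) (pair2_delta_id _ _ _ _ fL gL hL).
apply: etrans (test3_cflip12 _ _ _ _ _ _ _) _.
exact: etrans (test3_delta_id _ _ _ _ gL fL hL) (pair2_delta_id _ _ _ _ gL fL hL).
Qed.

Lemma test3_coassoc4_linear f j (y : Q j) g k (z : Q k) h l (t : Q l) :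
  form f -> form g -> form h ->
  linear (fun u => test3 f y g z h t (coassoc4 u) : K^o).
Proof.
move=> fL gL hL c u v; have E u' := test3_coassoc4 y z t u' fL gL hL.
apply: (etrans (E _)).
apply: (etrans _ (congr2 (fun p q : K^o => c *: p + q) (esym (E u)) (esym (E v)))).
by rewrite /id_delta_val /delta_id_val !tf_form /GRing.scale /=; ring.
Qed.

Local Notation cflipP := (co_flip brhd).
Local Notation crr := (co_rr brhd blhd).
Local Notation clb := (co_lb brhd blhd).
Local Notation clr := (co_lr brhd blhd).
Local Notation pr3 f g h t := (pr (pr f g) h t).

(** The first coefficient is [co_rr], and the third then gives [co_flip]. The fifth and second give
    [co_lb] and [co_lr], with the forms in the cyclic order [h], [f], [g]; the sixth and fourth
    repeat these with [f] and [g] exchanged. *)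
Lemma test3_coassoc4_pure f j (y : Q j) g k (z : Q k) h l (t : Q l) a x :
  form f -> form g -> form h ->
  test3 f y g z h t (coassoc4 (gpure a x)) =
  s6 (pr3 f g h (crr a))
     (pr3 h f g (clr a) - pr3 h f g (clb a))
     (pr3 f g h (cflipP a) - pr3 f g h (crr a))
     (pr3 h g f (clb a) - pr3 h g f (clr a))
     (pr3 h f g (clb a)) (- pr3 h g f (clb a)) x (dinj y) (dinj z) (dinj t).
Proof.
move=> fL gL hL; rewrite test3_coassoc4 // /id_delta_val /delta_id_val.
rewrite !tf_pure; do ?[exact: Br_form | exact: Bl_form].
rewrite !(varpiA qQ) /sum6 !pr_co_flip // !pr_co_rr // !pr_co_lb // !pr_co_lr //.
rewrite -/(word circ varpi _ _ _ _) /word; ring.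
Qed.

(** * Compatibility conditions as bilinear expressions in the two arguments *)

Lemma formI (U : lmodType K) (f : U -> K) :
  (forall c u v, f (c *: u + v) = c * f u + f v) -> form f.
Proof. by []. Qed.

Definition bilin (E : dsum L -> dsum L -> K) : Prop :=
  (forall v, form (E^~ v)) /\ (forall u, form (E u)).

Lemma bilinD E E' : bilin E -> bilin E' -> bilin (fun u v => E u v + E' u v).
Proof.
move=> [El Er] [E'l E'r]; split=> [v|u] c a b /=.
  by rewrite El E'l /GRing.scale /=; ring.
by rewrite Er E'r /GRing.scale /=; ring.
Qed.

Lemma bilinN E : bilin E -> bilin (fun u v => - E u v).
Proof.
move=> [El Er]; split=> [v|u] c a b /=.
  by rewrite El /GRing.scale /=; ring.
by rewrite Er /GRing.scale /=; ring.
Qed.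

Lemma bilinC E : bilin E -> bilin (fun u v => E v u).
Proof. by case. Qed.

Lemma bilin_eq0 E : bilin E ->
  (forall a i (x : Q i) b j (v : Q j), E (gpure a (dinj x)) (gpure b (dinj v)) =
    0) ->
  forall u v, E u v = 0.
Proof.
move=> [El Er] E0 u v.
have z0 : linear (fun _ : dsum L => 0 : K^o) by move=> c a b; rewrite scaler0 addr0.
move: u; apply: (@gtens_eq _ _ _ K^o _ _ (El v) z0) => a i x.
by move: v; apply: (@gtens_eq _ _ _ K^o _ _ (Er _) z0) => b j y; apply: E0.
Qed.

Lemma finform_comp f j (y : Q j) (F : dsum L -> dsum L) : form f -> cont F ->
  finform (fun u => tf f (dinj y) (F u)).
Proof.
move=> fL [FL Fc]; split; first by move=> c u v; rewrite FL tf_form.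
have [r r0] := Fc (- (j + m)); exists r => i u ir.
by rewrite (tf_hom _ _ fL (degE j)) r0 // (form0 (prv_form _ _)).
Qed.

Section BilinearTerms.
Variables (f g : P -> K) (j k : int) (y : Q j) (z : Q k).
Hypotheses (fL : form f) (gL : form g).
Let xi := tf f (dinj y).
Let eta := tf g (dinj z).

Let xf : finform xi. Proof. exact: tf_fin. Qed.
Let ef : finform eta. Proof. exact: tf_fin. Qed.

Lemma bilin_delta_dot : bilin (fun u v => pair2 xi eta (delta (dot u v))).
Proof.
have PL := pair2_form xf ef.
by split=> [v|u] c a b /=; rewrite ?dot_linl ?dot_linr delta_linear PL.
Qed.

Lemma bilin_dotl_l : bilin (fun u v => pair2 (fun t => xi (dot u t)) eta (delta v)).
Proof.
have uf u : finform (fun t => xi (dot u t)) := finform_comp y fL (cont_dotl u).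
split=> [v|u]; apply: formI => c a b;
  last by rewrite delta_linear (pair2_form (uf u) ef).
rewrite -[RHS](pair2_linl c _ (uf a) (uf b) ef).
by apply: eq_pair2 => // t; rewrite dot_linl; exact: tf_form.
Qed.

Lemma bilin_dotl_r : bilin (fun u v => pair2 xi (fun t => eta (dot u t)) (delta v)).
Proof.
have uf u : finform (fun t => eta (dot u t)) := finform_comp z gL (cont_dotl u).
split=> [v|u]; apply: formI => c a b;
  last by rewrite delta_linear (pair2_form xf (uf u)).
rewrite -[RHS](pair2_linr c _ xf (uf a) (uf b)).
by apply: eq_pair2 => // t; rewrite dot_linl; exact: tf_form.
Qed.

Lemma bilin_dotr_r : bilin (fun u v => pair2 xi (fun t => eta (dot t v)) (delta u)).
Proof.
have uf u : finform (fun t => eta (dot t u)) := finform_comp z gL (cont_dotr u).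
split=> [v|u]; apply: formI => c a b;
  first by rewrite delta_linear (pair2_form xf (uf v)).
rewrite -[RHS](pair2_linr c _ xf (uf a) (uf b)).
by apply: eq_pair2 => // t; rewrite dot_linr; exact: tf_form.
Qed.

End BilinearTerms.

(** * The compatibility conditions on pure tensors *)

Section PureTerms.
Variables (f g : P -> K) (y z : dsum Q).
Hypotheses (fL : form f) (gL : form g).
Variables (b : P) (v : dsum Q).

Lemma pair2_delta_pure : pair2 (tf f y) (tf g z) (delta (gpure b v)) =
  - pr f g (brhd b) * varpi v (circ y z) + pr g f (blhd b) * varpi v (circ z y).
Proof.
rewrite pair2_delta // !tf_pure ?mulNr //; do ?[exact: Br_form | exact: Bl_form].
Qed.
End PureTerms.

Section PureTerms2.
Variables (f g : P -> K) (y z : dsum Q).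
Hypotheses (fL : form f) (gL : form g).
Variables (a : P) (x : dsum Q) (b : P) (v : dsum Q).

(** One of the four shapes of term, with the three lemmas after it, from which both conditions are
    assembled by exchanging the tests or the arguments. *)
Lemma pair2_delta_dot_pure : pair2 (tf f y) (tf g z) (delta (dot (gpure a x)
  (gpure b v))) =
  - pr f g (brhd (rhd a b)) * varpi (circ x v) (circ y z)
  + pr g f (blhd (rhd a b)) * varpi (circ x v) (circ z y)
  + pr f g (brhd (lhd b a)) * varpi (circ v x) (circ y z)
  - pr g f (blhd (lhd b a)) * varpi (circ v x) (circ z y).
Proof.
have PL := pair2_form (tf_fin y fL) (tf_fin z gL).
rewrite dot_pure (linB delta_linear) (linB PL) !pair2_delta_pure //; ring.
Qed.

Lemma pair2_dotl_l_pure : pair2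
  (fun t => tf f y (dot (gpure a x) t)) (tf g z) (delta (gpure b v)) =
  pr (fun c => f (rhd a c)) g (brhd b) * varpi v (circ (circ x y) z)
  - pr g (fun c => f (rhd a c)) (blhd b) * varpi v (circ z (circ x y))
  + pr (fun c => f (lhd c a)) g (brhd b) * varpi v (circ (circ x y + circ y x) z)
  - pr g (fun c => f (lhd c a)) (blhd b) * varpi v (circ z (circ x y + circ y x)).
Proof.
have [rL lL] := (comp_rhdl a fL, comp_lhdr a fL).
rewrite (eq_pair2 _ (fun t => tf_dotl y a x t fL) (fun=> erefl)).
rewrite pair2Dl ?pair2Nl ?pair2_delta_pure //;
  do ?[exact: tf_fin | apply: finformN; exact: tf_fin].
ring.
Qed.

Lemma pair2_dotl_r_pure : pair2 (tf f y)
  (fun t => tf g z (dot (gpure a x) t)) (delta (gpure b v)) =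
  pr f (fun c => g (rhd a c)) (brhd b) * varpi v (circ y (circ x z))
  - pr (fun c => g (rhd a c)) f (blhd b) * varpi v (circ (circ x z) y)
  + pr f (fun c => g (lhd c a)) (brhd b) * varpi v (circ y (circ x z + circ z x))
  - pr (fun c => g (lhd c a)) f (blhd b) * varpi v (circ (circ x z + circ z x) y).
Proof.
have [rL lL] := (comp_rhdl a gL, comp_lhdr a gL).
rewrite (eq_pair2 _ (fun=> erefl) (fun t => tf_dotl z a x t gL)).
rewrite pair2Dr ?pair2Nr ?pair2_delta_pure //;
  do ?[exact: tf_fin | apply: finformN; exact: tf_fin].
ring.
Qed.

Lemma pair2_dotr_r_pure : pair2 (tf f y)
  (fun t => tf g z (dot t (gpure b v))) (delta (gpure a x)) =
  - pr f (fun c => g (rhd c b)) (brhd a) * varpi x (circ y (circ v z + circ z v))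
  + pr (fun c => g (rhd c b)) f (blhd a) * varpi x (circ (circ v z + circ z v) y)
  - pr f (fun c => g (lhd b c)) (brhd a) * varpi x (circ y (circ v z))
  + pr (fun c => g (lhd b c)) f (blhd a) * varpi x (circ (circ v z) y).
Proof.
have [rL lL] := (comp_rhdr b gL, comp_lhdl b gL).
rewrite (eq_pair2 _ (fun=> erefl) (fun t => tf_dotr z b v t gL)).
rewrite pair2Dr ?pair2_delta_pure //; do ?exact: tf_fin.
ring.
Qed.
End PureTerms2.

(** The first compatibility condition with every multiplication and flip moved onto the forms;
    [compat2] is the second one. *)
Definition compat1 (xi eta : dsum L -> K) (u v : dsum L) : K :=
  pair2 xi eta (delta (dot u v)) - pair2 eta xi (delta (dot u v))
  - (pair2 (fun t => xi (dot u t)) eta (delta v) - pair2 eta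
    (fun t => xi (dot u t)) (delta v))
  - (pair2 xi (fun t => eta (dot u t)) (delta v) - pair2
    (fun t => eta (dot u t)) xi (delta v))
  - pair2 xi (fun t => eta (dot t v)) (delta u)
    + pair2 eta (fun t => xi (dot t v)) (delta u).

Definition compat2 (xi eta : dsum L -> K) (u v : dsum L) : K :=
  pair2 xi eta (delta (dot u v)) - pair2 xi eta (delta (dot v u))
  - (pair2 xi (fun t => eta (dot t v)) (delta u) - pair2 xi
    (fun t => eta (dot v t)) (delta u))
  - (pair2 xi (fun t => eta (dot u t)) (delta v) - pair2 xi
    (fun t => eta (dot t u)) (delta v))
  - pair2 (fun t => xi (dot u t)) eta (delta v)
    + pair2 (fun t => xi (dot v t)) eta (delta u).

Lemma bilin_compat1 f g j k (y : Q j) (z : Q k) : form f -> form g ->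
  bilin (compat1 (tf f (dinj y)) (tf g (dinj z))).
Proof.
move=> fL gL; apply: bilinD (bilin_dotr_r z y gL fL).
apply: bilinD (bilinN (bilin_dotr_r y z fL gL)).
apply: bilinD (bilinN (bilinD (bilin_dotl_r y z fL gL)
                              (bilinN (bilin_dotl_l z y gL fL)))).
apply: bilinD (bilinN (bilinD (bilin_dotl_l y z fL gL)
                              (bilinN (bilin_dotl_r z y gL fL)))).
exact: bilinD (bilin_delta_dot y z fL gL) (bilinN (bilin_delta_dot z y gL fL)).
Qed.

Lemma bilin_compat2 f g j k (y : Q j) (z : Q k) : form f -> form g ->
  bilin (compat2 (tf f (dinj y)) (tf g (dinj z))).
Proof.
move=> fL gL; apply: bilinD (bilinC (bilin_dotl_l y z fL gL)).
apply: bilinD (bilinN (bilin_dotl_l y z fL gL)).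
apply: bilinD (bilinN (bilinD (bilin_dotl_r y z fL gL)
                              (bilinN (bilinC (bilin_dotr_r y z fL gL))))).
apply: bilinD (bilinN (bilinD (bilin_dotr_r y z fL gL)
                              (bilinN (bilinC (bilin_dotl_r y z fL gL))))).
exact: bilinD (bilin_delta_dot y z fL gL)
  (bilinN (bilinC (bilin_delta_dot y z fL gL))).
Qed.

Local Notation b1 := (bi_1 rhd lhd blhd).
Local Notation b2l := (bi_2l rhd lhd brhd blhd).
Local Notation b2r := (bi_2r rhd lhd brhd blhd).
Local Notation b3 := (bi_3 rhd lhd brhd blhd).
Local Notation b4 := (bi_4 lhd brhd blhd).
Local Notation b5 := (bi_5 rhd lhd brhd blhd).

Lemma varpi_form x : form (varpi x).
Proof. exact: (varpi_linr qQ). Qed.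

Lemma varpi_circ2 x v y z :
  varpi (circ x v) (circ y z) = w x v y z + w x y z v - w x z y v.
Proof. by rewrite (circ_adjr qQ) (formD (varpi_form x)) (varpiA qQ) addrA. Qed.

Lemma varpi_circ2l x v y z : varpi (circ v x) (circ y z) = - w x v y z.
Proof. exact: (circ_adjl qQ). Qed.

(** Replaces all eight terms of [compat1] or [compat2] at once, by position. *)
Lemma eq_alt8 (A B C D E F G H A' B' C' D' E' F' G' H' : K) :
  A = A' -> B = B' -> C = C' -> D = D' -> E = E' -> F = F' -> G = G' -> H = H' ->
  A - B - (C - D) - (E - F) - G + H = A' - B' - (C' - D') - (E' - F') - G' + H'.
Proof. by do 8!move=> ->. Qed.

(** The first condition carries [bi_2r], [bi_2l] and [bi_4]: up to sign the first coefficient is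
    [bi_2r], the third then yields [bi_2l], and the sixth yields [bi_4]. *)
Lemma compat1_pure f g y z a x b v : form f -> form g ->
  compat1 (tf f y) (tf g z) (gpure a x) (gpure b v) =
  s6 (- pr f g (b2r a b)) (pr g f (b2r a b))
     (pr f g (b2r a b) - pr f g (b2l a b))
     (- pr f g (b2l a b) - pr g f (b2r a b) - pr g f (b4 a b))
     (pr g f (b2l a b) - pr g f (b2r a b))
     (pr f g (b2r a b) + pr f g (b4 a b) + pr g f (b2l a b)) x v y z.
Proof.
move=> fL gL.
(* Each coefficient is abstracted to a variable before its expansion is substituted, so that the
   rewriting touches it alone. *)
move: (pr_bi_2r rhd lhd brL blL fL gL a b); generalize (pr f g (b2r a b)) => _ ->.
move: (pr_bi_2r rhd lhd brL blL gL fL a b); generalize (pr g f (b2r a b)) => _ ->.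
move: (pr_bi_2l rhd lhd brL blL fL gL a b); generalize (pr f g (b2l a b)) => _ ->.
move: (pr_bi_2l rhd lhd brL blL gL fL a b); generalize (pr g f (b2l a b)) => _ ->.
move: (pr_bi_4 brhd blhd lB fL gL a b); generalize (pr f g (b4 a b)) => _ ->.
move: (pr_bi_4 brhd blhd lB gL fL a b); generalize (pr g f (b4 a b)) => _ ->.
apply: (etrans (eq_alt8 (pair2_delta_dot_pure y z fL gL a x b v)
  (pair2_delta_dot_pure z y gL fL a x b v) (pair2_dotl_l_pure y z fL gL a x b v)
  (pair2_dotl_r_pure z y gL fL a x b v) (pair2_dotl_r_pure y z fL gL a x b v)
  (pair2_dotl_l_pure z y gL fL a x b v) (pair2_dotr_r_pure y z fL gL a x b v)
  (pair2_dotr_r_pure z y gL fL a x b v))).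
rewrite !(varpi_circ2l x v) !varpi_circ2 !(varpiDr qQ) !(varpiDl qQ) !(varpiA qQ).
rewrite -!/(word circ varpi _ _ _ _).
(* Terms where [delta] acts on the second argument give words starting with [v]; all are brought to
   first letter [x]. *)
rewrite !(word_first qQ v x) !(word_second qQ v _ x) !(word_third qQ v _ _ x).
rewrite /sum6; ring.
Qed.

(** The second condition adds [bi_1], [bi_3] and [bi_5], which the second, fourth and sixth
    coefficients determine; the other three are combinations of these with [bi_2l] and [bi_2r]. *)
Lemma compat2_pure f g y z a x b v : form f -> form g ->
  compat2 (tf f y) (tf g z) (gpure a x) (gpure b v) =
  s6 (pr f g (b1 a b) - pr f g (b2r a b) - pr f g (b2l b a))
     (pr g f (b1 a b))
     (pr f g (b1 b a) - pr f g (b1 a b) - pr f g (b2l a b) + pr f g (b2r a b)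
      + pr f g (b2l b a) - pr f g (b2r b a))
     (- pr f g (b3 a b))
     (pr f g (b1 a b) - pr g f (b1 a b) - pr f g (b2r a b) - pr f g (b2l b a)
      + pr f g (b3 a b) + pr f g (b3 b a) - pr f g (b5 a b))
     (pr f g (b3 a b) - pr f g (b5 a b)) x v y z.
Proof.
move=> fL gL.
move: (pr_bi_1 rhd lhd blL fL gL a b); generalize (pr f g (b1 a b)) => _ ->.
move: (pr_bi_1 rhd lhd blL gL fL a b); generalize (pr g f (b1 a b)) => _ ->.
move: (pr_bi_1 rhd lhd blL fL gL b a); generalize (pr f g (b1 b a)) => _ ->.
move: (pr_bi_2r rhd lhd brL blL fL gL a b); generalize (pr f g (b2r a b)) => _ ->.
move: (pr_bi_2l rhd lhd brL blL fL gL b a); generalize (pr f g (b2l b a)) => _ ->.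
move: (pr_bi_2l rhd lhd brL blL fL gL a b); generalize (pr f g (b2l a b)) => _ ->.
move: (pr_bi_2r rhd lhd brL blL fL gL b a); generalize (pr f g (b2r b a)) => _ ->.
move: (pr_bi_3 lhd rB brL blL fL gL a b); generalize (pr f g (b3 a b)) => _ ->.
move: (pr_bi_3 lhd rB brL blL fL gL b a); generalize (pr f g (b3 b a)) => _ ->.
move: (pr_bi_5 brhd blhd rB lB fL gL a b); generalize (pr f g (b5 a b)) => _ ->.
apply: (etrans (eq_alt8 (pair2_delta_dot_pure y z fL gL a x b v)
  (pair2_delta_dot_pure y z fL gL b v a x) (pair2_dotr_r_pure y z fL gL a x b v)
  (pair2_dotl_r_pure y z fL gL b v a x) (pair2_dotl_r_pure y z fL gL a x b v)
  (pair2_dotr_r_pure y z fL gL b v a x) (pair2_dotl_l_pure y z fL gL a x b v)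
  (pair2_dotl_l_pure y z fL gL b v a x))).
rewrite !(varpi_circ2l x v) !varpi_circ2 !(varpiDr qQ) !(varpiDl qQ) !(varpiA qQ).
rewrite -!/(word circ varpi _ _ _ _).
rewrite !(word_first qQ v x) !(word_second qQ v _ x) !(word_third qQ v _ _ x).
rewrite /sum6; ring.
Qed.

(** * From identities of formal sums to identities on forms *)

Lemma pair2_cobracket (xi eta : dsum L -> K) (t : ctens L L) :
  finform xi -> finform eta ->
  pair2 xi eta (t - cflip t) = pair2 xi eta t - pair2 eta xi t.
Proof.
move=> fx fe; apply: (etrans (linB (pair2_form fx fe) _ _)).
by rewrite (pair2_cflip t fx.1 fe.1).
Qed.

Section Tests.
Variables (f g : P -> K) (j k : int) (y : Q j) (z : Q k).
Hypotheses (fL : form f) (gL : form g).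
Let xi := tf f (dinj y).
Let eta := tf g (dinj z).

Lemma pair2_comb (t1 t2 t3 t4 t5 : ctens L L) :
  pair2 xi eta (t1 - t2 - t3 - t4 + t5) =
  pair2 xi eta t1 - pair2 xi eta t2 - pair2 xi eta t3 - pair2 xi eta t4
    + pair2 xi eta t5.
Proof.
have PL := pair2_form (tf_fin (dinj y) fL) (tf_fin (dinj z) gL).
by rewrite (linD PL) !(linB PL).
Qed.

Lemma compat1E u v :
  pair2 xi eta (delta (dot u v) - cflip (delta (dot u v))
    - cmap (dot u) id (delta v - cflip (delta v))
    - cmap id (dot u) (delta v - cflip (delta v))
    - cmap id (dot^~ v) (delta u) + cmap (dot^~ v) id (cflip (delta u)))
  = compat1 xi eta u v.
Proof.
have [xf ef] := (tf_fin (dinj y) fL, tf_fin (dinj z) gL).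
have c2 := fun t => pair2_cmap y z t fL gL (cont_dotl u) (cont_id _).
have c3 := fun t => pair2_cmap y z t fL gL (cont_id _) (cont_dotl u).
have c4 := pair2_cmap y z (delta u) fL gL (cont_id _) (cont_dotr v).
have c5 := pair2_cmap y z (cflip (delta u)) fL gL (cont_dotr v) (cont_id _).
have fl := finform_comp y fL (cont_dotl u);
  have gl := finform_comp z gL (cont_dotl u).
have fr := finform_comp y fL (cont_dotr v).
apply: (etrans (pair2_comb _ _ _ _ _)); rewrite /compat1; congr (_ - _ - _ - _ + _).
- exact: pair2_cobracket xf ef.
- exact: (etrans (c2 _) (pair2_cobracket _ fl ef)).
- exact: (etrans (c3 _) (pair2_cobracket _ xf gl)).
- exact: c4.
- exact: (etrans c5 (pair2_cflip _ fr.1 ef.1)).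
Qed.

Lemma compat2E u v :
  pair2 xi eta (delta (dot u v - dot v u)
    - cmap id (fun t => dot t v - dot v t) (delta u)
    - cmap id (fun t => dot u t - dot t u) (delta v)
    - cmap (dot u) id (delta v) + cmap (dot v) id (delta u))
  = compat2 xi eta u v.
Proof.
have [xf ef] := (tf_fin (dinj y) fL, tf_fin (dinj z) gL).
have contB F G : cont F -> cont G -> cont (fun t : dsum L => F t - G t : dsum L).
  move=> Fc Gc; have := cont_lin (-1) Gc Fc.
  by rewrite (_ : (fun _ => -1 *: _ + _) = fun t => F t - G t) //;
    apply: funext => t; rewrite scaleN1r addrC.
have lr u' v' t : pair2 (tf f (dinj y))
  (fun t => tf g (dinj z) (dot t v' - dot u' t)) t =
    pair2 xi (fun t => eta (dot t v')) t - pair2 xi (fun t => eta (dot u' t)) t.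
  have gr := finform_comp z gL (cont_dotr v').
  have gl := finform_comp z gL (cont_dotl u').
  rewrite -pair2Nr; apply: (etrans _ (pair2Dr _ xf gr (finformN gl))).
  by apply: eq_pair2 => // s; rewrite (formB (@tf_form _ _)).
have rl' u' v' t : pair2 (tf f (dinj y))
  (fun t => tf g (dinj z) (dot u' t - dot t v')) t =
    pair2 xi (fun t => eta (dot u' t)) t - pair2 xi (fun t => eta (dot t v')) t.
  have gr := finform_comp z gL (cont_dotr v').
  have gl := finform_comp z gL (cont_dotl u').
  rewrite -pair2Nr; apply: (etrans _ (pair2Dr _ xf gl (finformN gr))).
  by apply: eq_pair2 => // s; rewrite (formB (@tf_form _ _)).
apply: (etrans (pair2_comb _ _ _ _ _)); rewrite /compat2; congr (_ - _ - _ - _ + _).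
- rewrite (linB delta_linear); exact: (linB (pair2_form xf ef)).
- exact: (etrans (pair2_cmap y z _ fL gL (cont_id _) (contB _ _ (cont_dotr v)
  (cont_dotl v))) (lr _ _ _)).
- exact: (etrans (pair2_cmap y z _ fL gL (cont_id _) (contB _ _ (cont_dotl u)
  (cont_dotr u))) (rl' _ _ _)).
- exact: (pair2_cmap y z _ fL gL (cont_dotl u) (cont_id _)).
- exact: (pair2_cmap y z _ fL gL (cont_dotl v) (cont_id _)).
Qed.

End Tests.

(** Well-definedness of the composites follows from finiteness in each component, so only four
    equations remain, and the two in the completed product may be tested on forms. *)
Lemma completed_pre_lie_bialgebraP :
  completed_pre_lie_bialgebra dot delta <->
  [/\ forall u v t, assoc4 u v t = 0,
      forall u, coassoc4 u = 0,
      forall f g j k (y : Q j) (z : Q k), form f -> form g ->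
        forall u v, compat1 (tf f (dinj y)) (tf g (dinj z)) u v = 0
    & forall f g j k (y : Q j) (z : Q k), form f -> form g ->
        forall u v, compat2 (tf f (dinj y)) (tf g (dinj z)) u v = 0].
Proof.
have pair20 f g j k (y : Q j) (z : Q k) : form f -> form g ->
    pair2 (tf f (dinj y)) (tf g (dinj z)) (0 : ctens L L) = 0.
  by move=> fL gL; exact: (lin0 (pair2_form (tf_fin _ fL) (tf_fin _ gL))).
split=> [[[_ A] [_ _ _ C] _ _ _ _ c1 c2]|[A C c1 c2]].
  split=> [u v t|u|f g j k y z fL gL u v|f g j k y z fL gL u v].
  - by apply/eqP; rewrite subr_eq0; apply/eqP/A.
  - by apply/eqP; rewrite subr_eq0; apply/eqP/C.
  - by rewrite -compat1E // c1 pair20.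
  - by rewrite -compat2E // c2 pair20.
split.
- split; first by split; [exact: dot_linl | exact: dot_linr].
  by move=> u v t; apply/eqP; rewrite -subr_eq0; apply/eqP/A.
- split=> [|u|u|u]; first exact: delta_linear.
  + exact: id_delta_defined.
  + exact: delta_id_defined.
  + by apply/eqP; rewrite -subr_eq0; apply/eqP/C.
- by move=> u v; apply: cont_cmap_defined; [exact: cont_dotl | exact: cont_id].
- by move=> u v; apply: cont_cmap_defined; [exact: cont_id | exact: cont_dotl].
- by move=> u v; apply: cont_cmap_defined; [exact: cont_dotr | exact: cont_id].
- by move=> u v; apply: cont_cmap_defined; [exact: cont_id | exact: cont_dotr].
- move=> u v; apply: tf_sep2 => f g j k y z fL gL.
  by apply: (etrans (compat1E y z fL gL u v)); apply: c1.
move=> u v; apply: tf_sep2 => f g j k y z fL gL.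
by apply: (etrans (compat2E y z fL gL u v)); apply: c2.
Qed.

Lemma tf_assoc4_linear f q v t : form (fun u => tf f q (assoc4 u v t)).
Proof.
apply: formI => c a b; have tL := @tf_form f q.
by rewrite /assoc4 !(dot_linl, dot_linr) /= !(formB tL) !tL /GRing.scale /=; ring.
Qed.

Lemma tf_assoc4_linear3 f q u v : form (fun t => tf f q (assoc4 u v t)).
Proof.
apply: formI => c a b; have tL := @tf_form f q.
by rewrite /assoc4 !(dot_linl, dot_linr) /= !(formB tL) !tL /GRing.scale /=; ring.
Qed.

Lemma assoc4C u v t : assoc4 u v t = - assoc4 v u t.
Proof. by rewrite /assoc4 [RHS]opprB. Qed.

Lemma assoc4_eq0 :
  (forall a b c i j k (x : Q i) (y : Q j) (z : Q k),
     assoc4 (gpure a (dinj x)) (gpure b (dinj y)) (gpure c (dinj z)) = 0) ->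
  forall u v t, assoc4 u v t = 0.
Proof.
move=> A u v t; apply: tf_sep => f l q fL.
have z0 : linear (fun _ : dsum L => 0 : K^o) by move=> c a b; rewrite scaler0 addr0.
move: u; apply: (@gtens_eq _ _ _ K^o _ _ (tf_assoc4_linear f (dinj q) v t) z0) =>
  a i x.
(* Antisymmetry brings [v] to the first slot, where linearity has been established. *)
rewrite assoc4C (formN (@tf_form _ _)); apply/eqP; rewrite oppr_eq0; apply/eqP.
move: v; apply: (@gtens_eq _ _ _ K^o _ _ (tf_assoc4_linear f (dinj q) _ t) z0) =>
  b j y.
move: t; apply: (@gtens_eq _ _ _ K^o _ _ (tf_assoc4_linear3 f (dinj q) _ _) z0)
  => c k z.
by rewrite A (form0 (@tf_form _ _)).
Qed.

Lemma sum6_0 x y z t : s6 0 0 0 0 0 0 x y z t = 0.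
Proof. by rewrite /sum6 !mul0r !addr0. Qed.

(** * Passage between the two bialgebra structures *)

Lemma completed_pre_lie_of_zinbiel_dendriform :
  zinbiel_dendriform_bialgebra rhd lhd brhd blhd ->
  completed_pre_lie_bialgebra dot delta.
Proof.
move=> /(zinbiel_dendriform_bialgebraP rB lB brL blL)[A C B B'].
have f0 f : form f -> f 0 = 0 := @form0 _ _ f.
have p0 f g : pr f g (0 : tens P P) = 0 := form0 (@pr_form _ P P f g).
have p30 f g h : pr3 f g h (0 : tens (tens P P) P) = 0 :=
  form0 (@pr_form _ _ _ _ _).
apply/completed_pre_lie_bialgebraP; split.
- apply: assoc4_eq0 => a b c i j k x y z; apply: tf_sep => f l q fL.
  rewrite tf_assoc //; case: (A a b c) (A b a c) => -> -> -> [-> -> ->].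
  by rewrite !(f0 f fL) !oppr0 !addr0 sum6_0.
- move=> u; apply: test3_sep => f g h j k l y z t fL gL hL.
  have z0 : linear (fun _ : dsum L => 0 : K^o) by move=> c a b;
    rewrite scaler0 addr0.
  move: u; apply: (@gtens_eq _ _ _ K^o _ _ (test3_coassoc4_linear y z t fL gL hL)
    z0).
  move=> a i x; apply: (etrans (test3_coassoc4_pure y z t a (dinj x) fL gL hL)).
  by case: (C a) => -> -> -> ->; rewrite !p30 !oppr0 !addr0 sum6_0.
- move=> f g j k y z fL gL; apply: bilin_eq0 (bilin_compat1 y z fL gL) _.
  move=> a i x b l v; apply: (etrans (compat1_pure _ _ a (dinj x) b (dinj v) fL
    gL)).
  case: (B a b) (B' a b) => _ -> -> [_ -> _].
  by rewrite !p0 !oppr0 !addr0 sum6_0.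
move=> f g j k y z fL gL; apply: bilin_eq0 (bilin_compat2 y z fL gL) _.
move=> a i x b l v; apply: (etrans (compat2_pure _ _ a (dinj x) b (dinj v) fL gL)).
case: (B a b) (B b a) (B' a b) (B' b a) => -> -> -> [-> -> ->] [-> _ ->] [-> _ _].
by rewrite !p0 !oppr0 !addr0 sum6_0.
Qed.

(** Linear independence of the six words as functions of homogeneous letters: the extra condition on
    [Q] under which the converse is proved. *)
Definition words_free : Prop := forall c1 c2 c3 c4 c5 c6 : K,
  (forall i j k l (x : Q i) (y : Q j) (z : Q k) (t : Q l),
     s6 c1 c2 c3 c4 c5 c6 (dinj x) (dinj y) (dinj z) (dinj t) = 0) ->
  [/\ c1 = 0, c2 = 0 & c3 = 0] /\ [/\ c4 = 0, c5 = 0 & c6 = 0].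

Lemma zinbiel_dendriform_of_completed_pre_lie : words_free ->
  completed_pre_lie_bialgebra dot delta ->
  zinbiel_dendriform_bialgebra rhd lhd brhd blhd.
Proof.
move=> free /completed_pre_lie_bialgebraP[A C B B'].
apply/(zinbiel_dendriform_bialgebraP rB lB brL blL).
have s1 := form_separates P; have s2 := prs_separates s1 s1.
have s3 := prs_separates s2 s1.
have opp0 (x : K) : - x = 0 -> x = 0 by move=> /eqP; rewrite oppr_eq0 => /eqP.
(* The fifth coefficient is the value on [alg_la], after which the second leaves the one on
   [alg_rl]. *)
have A6 f a b c : form f ->
    [/\ f (rr a b c) = 0, f (rl a b c) = 0 & f (la a b c) = 0].
  move=> fL; have [|[c1 c2 _] [_ c5 _]] := free (f (rr a b c))
    (- f (rl a b c) - f (la a b c)) (- f (rr b a c))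
    (f (rl b a c) + f (la b a c)) (f (la a b c)) (- f (la b a c)).
    move=> i j k l q x y z; rewrite -tf_assoc //.
    by rewrite A (form0 (@tf_form _ _)).
  by split=> //; apply: opp0; rewrite -c2 c5 subr0.
have C6 f g h a : form f -> form g -> form h ->
    [/\ pr3 f g h (cflipP a) = 0, pr3 f g h (crr a) = 0,
        pr3 h f g (clb a) = 0 & pr3 h f g (clr a) = 0].
  move=> fL gL hL; have [|[c1 c2 c3] [_ c5 _]] := free (pr3 f g h (crr a))
     (pr3 h f g (clr a) - pr3 h f g (clb a))
     (pr3 f g h (cflipP a) - pr3 f g h (crr a))
     (pr3 h g f (clb a) - pr3 h g f (clr a))
     (pr3 h f g (clb a)) (- pr3 h g f (clb a)).
    move=> i j k l x y z t.
    apply: (etrans (esym (test3_coassoc4_pure y z t a (dinj x) fL gL hL))).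
    by rewrite C; exact: (lin0 (test3_form _ _ _ _ _ _)).
  by split=> //; [rewrite -c3 c1 subr0 | rewrite -c2 c5 subr0].
have B6 f g a b : form f -> form g ->
    [/\ pr f g (b2l a b) = 0, pr f g (b2r a b) = 0 & pr f g (b4 a b) = 0].
  move=> fL gL; have [|[c1 c2 c3] [_ c5 c6]] :=
    free (- pr f g (b2r a b)) (pr g f (b2r a b))
     (pr f g (b2r a b) - pr f g (b2l a b))
     (- pr f g (b2l a b) - pr g f (b2r a b) - pr g f (b4 a b))
     (pr g f (b2l a b) - pr g f (b2r a b))
     (pr f g (b2r a b) + pr f g (b4 a b) + pr g f (b2l a b)).
    move=> i l j k x v y z.
    apply: (etrans (esym (compat1_pure _ _ a (dinj x) b (dinj v) fL gL))).
    exact: B.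
  (* The system is solved in the order [bi_2r], [bi_2l], [bi_4]; the last also uses [bi_2l] with the
     forms exchanged, from the second and fifth coefficients. *)
  have r0 := opp0 _ c1; have l0 : pr f g (b2l a b) = 0.
    by apply: opp0; rewrite -c3 r0 sub0r.
  split=> //; move: c5; rewrite c2 subr0 => c5.
  by rewrite -c6 r0 c5 addr0 add0r.
have B6' f g a b : form f -> form g ->
    [/\ pr g f (b1 a b) = 0, pr f g (b3 a b) = 0 & pr f g (b5 a b) = 0].
  move=> fL gL; have [|[_ c2 _] [c4 _ c6]] := free
     (pr f g (b1 a b) - pr f g (b2r a b) - pr f g (b2l b a))
     (pr g f (b1 a b))
     (pr f g (b1 b a) - pr f g (b1 a b) - pr f g (b2l a b) + pr f g (b2r a b)
      + pr f g (b2l b a) - pr f g (b2r b a))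
     (- pr f g (b3 a b))
     (pr f g (b1 a b) - pr g f (b1 a b) - pr f g (b2r a b) - pr f g (b2l b a)
      + pr f g (b3 a b) + pr f g (b3 b a) - pr f g (b5 a b))
     (pr f g (b3 a b) - pr f g (b5 a b)).
    move=> i l j k x v y z.
    apply: (etrans (esym (compat2_pure _ _ a (dinj x) b (dinj v) fL gL))).
    exact: B'.
  have b30 := opp0 _ c4; split=> //.
  by apply: opp0; rewrite -c6 b30 sub0r.
split=> [a b c|a|a b|a b]; split.
- by apply: s1.2 => f fL; case: (A6 f a b c fL).
- by apply: s1.2 => f fL; case: (A6 f a b c fL).
- by apply: s1.2 => f fL; case: (A6 f a b c fL).
- apply: s3.2 => _ [_ [h [[f [g [fL gL ->]]] hL ->]]].
  by case: (C6 f g h a fL gL hL).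
- apply: s3.2 => _ [_ [h [[f [g [fL gL ->]]] hL ->]]].
  by case: (C6 f g h a fL gL hL).
(* The last two coalgebra axioms come with the forms cyclically permuted, so the forms are shifted
   in advance. *)
- apply: s3.2 => _ [_ [h [[f [g [fL gL ->]]] hL ->]]].
  by case: (C6 g h f a gL hL fL).
- apply: s3.2 => _ [_ [h [[f [g [fL gL ->]]] hL ->]]].
  by case: (C6 g h f a gL hL fL).
- by apply: s2.2 => _ [f [g [fL gL ->]]]; case: (B6' g f a b gL fL).
- by apply: s2.2 => _ [f [g [fL gL ->]]]; case: (B6 f g a b fL gL).
- by apply: s2.2 => _ [f [g [fL gL ->]]]; case: (B6 f g a b fL gL).
- by apply: s2.2 => _ [f [g [fL gL ->]]]; case: (B6' f g a b fL gL).
- by apply: s2.2 => _ [f [g [fL gL ->]]]; case: (B6 f g a b fL gL).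
- by apply: s2.2 => _ [f [g [fL gL ->]]]; case: (B6' f g a b fL gL).
Qed.

End TensorPreLie.

(** * Bilinear maps defined degree by degree *)

Section FiniteDoubleSum.
Variables (K : fieldType) (U V : grading K) (X : lmodType K).
Variable G : forall i j, U i -> V j -> X.
Hypothesis GB : forall i j, is_bilinear (@G i j).

(** The common shape of [WL_circ] and [WL_form], so that bilinearity and values on homogeneous
    elements are proved once. *)
Definition dsum_bil (x : dsum U) (y : dsum V) : X :=
  \sum_(i \in [set: int]%classic) \sum_(j \in [set: int]%classic) G (x i) (y j).

Lemma dsum_bilE (x : dsum U) (y : dsum V) (r r' : seq int) : uniq r -> uniq r' ->
  (forall i, i \notin r -> x i = 0) -> (forall i, i \notin r' -> y i = 0) ->
  dsum_bil x y = \sum_(i <- r) \sum_(j <- r') G (x i) (y j).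
Proof.
move=> ur ur' x0 y0; have inner i :
    \sum_(j \in [set: int]%classic) G (x i) (y j) = \sum_(j <- r') G (x i) (y j).
  by apply: fsumE => // j /y0 ->; exact: (lin0 ((GB i j).2 _)).
rewrite /dsum_bil (fsumE ur) => [|i ir]; first by apply: eq_bigr.
by rewrite inner big1 // => j _; rewrite x0 //; exact: (lin0 ((GB i j).1 _)).
Qed.

Lemma dsum_bil_bilinear : is_bilinear dsum_bil.
Proof.
have supp2 (W : grading K) (x x' : dsum W) : exists r : seq int, [/\ uniq r,
    forall i, i \notin r -> x i = 0 & forall i, i \notin r -> x' i = 0].
  have [r _ x0] := dsum_supp x; have [r' _ x'0] := dsum_supp x'.
  exists (undup (r ++ r')); split=> [|i|i]; first exact: undup_uniq.
    by rewrite mem_undup mem_cat negb_or => /andP[/x0].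
  by rewrite mem_undup mem_cat negb_or => /andP[_ /x'0].
have lin00 (W : grading K) (x x' : dsum W) c i : x i = 0 -> x' i = 0 ->
    (c *: x + x') i = 0.
  by move=> xi x'i; rewrite component_linear xi x'i scaler0 addr0.
split=> [y|x] c.
  move=> x x'; rewrite -[RHS]/(c *: dsum_bil x y + dsum_bil x' y).
  have [r [ur x0 x'0]] := supp2 _ x x'; have [q uq y0] := dsum_supp y.
  have xx0 i : i \notin r -> (c *: x + x') i = 0.
    by move=> ir; apply: lin00; [exact: x0 | exact: x'0].
  rewrite (dsum_bilE ur uq x0 y0) (dsum_bilE ur uq x'0 y0) (dsum_bilE ur uq xx0 y0).
  rewrite scaler_sumr -big_split; apply: eq_bigr => i _ /=.
  rewrite scaler_sumr -big_split; apply: eq_bigr => j _ /=.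
  exact: (GB i j).1.
move=> y y'; rewrite -[RHS]/(c *: dsum_bil x y + dsum_bil x y').
have [r [ur y0 y'0]] := supp2 _ y y'; have [q uq x0] := dsum_supp x.
have yy0 i : i \notin r -> (c *: y + y') i = 0.
  by move=> ir; apply: lin00; [exact: y0 | exact: y'0].
rewrite (dsum_bilE uq ur x0 y0) (dsum_bilE uq ur x0 y'0) (dsum_bilE uq ur x0 yy0).
rewrite scaler_sumr -big_split; apply: eq_bigr => i _ /=.
rewrite scaler_sumr -big_split; apply: eq_bigr => j _ /=.
exact: (GB i j).2.
Qed.

Lemma dsum_bil_dinj i (u : U i) j (v : V j) : dsum_bil (dinj u) (dinj v) = G u v.
Proof.
rewrite /dsum_bil (fsum1 (x0 := i)) => [|k ki].
  rewrite (fsum1 (x0 := j)) ?dinj_same // => k kj.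
  by rewrite [dinj v k]dinj_out //; exact: (lin0 ((GB i k).2 _)).
by rewrite fsbig1 // => l _; rewrite [dinj u k]dinj_out //;
  exact: (lin0 ((GB k l).1 _)).
Qed.

End FiniteDoubleSum.

(** * The Laurent algebra *)

Section LaurentAlgebra.
Variable K : fieldType.
Local Notation W := 'rV[K]_4.

(* eps 1, ..., eps 4 are dual to the coordinates ord0, i1, i2, i3. *)
Let i1 : 'I_4 := lift ord0 ord0.
Let i2 : 'I_4 := lift ord0 (lift ord0 ord0).
Let i3 : 'I_4 := lift ord0 (lift ord0 (lift ord0 ord0)).

Lemma rV4P (x y : W) : x 0 ord0 = y 0 ord0 -> x 0 i1 = y 0 i1 ->
  x 0 i2 = y 0 i2 -> x 0 i3 = y 0 i3 -> x = y.
Proof.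
move=> e0 e1 e2 e3; apply/rowP => j.
case: (unliftP ord0 j) => [j1|] -> //; case: (unliftP ord0 j1) => [j2|] -> //.
case: (unliftP ord0 j2) => [j3|] -> //.
by rewrite [j3]ord1.
Qed.

(** A tuple rather than a conjunction, so that it serves as a rewriting multirule. *)
Lemma W_circE (x y : W) :
  ((W_circ x y 0 ord0 = x 0 i1 * y 0 ord0 + x 0 i1 * y 0 i1 :> K)%R *
   (W_circ x y 0 i1 = 0 :> K)%R *
   (W_circ x y 0 i2 = x 0 i2 * y 0 i1 - x 0 i1 * y 0 i2 :> K)%R *
   (W_circ x y 0 i3 =
      x 0 i2 * y 0 ord0 + 2%:R * (x 0 i2 * y 0 i1) - x 0 i1 * y 0 i2 :> K)%R)%type.
Proof.
rewrite /W_circ !big_ord_recl !big_ord0 /= /bump /= !mxE /=.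
by do 3?split; ring.
Qed.

Lemma nuE (x y : W) :
  nu x y = x 0 ord0 * y 0 i2 + x 0 i1 * y 0 i3 - x 0 i2 * y 0 ord0 - x 0 i3 * y 0
    i1.
Proof. by rewrite /nu !big_ord_recl !big_ord0 /= /bump /=; ring. Qed.

Lemma W_circ_bilinear : is_bilinear (@W_circ K).
Proof.
split=> [y|x] a u v.
  rewrite -[RHS]/(a *: W_circ u y + W_circ v y).
  by apply: rV4P; rewrite !mxE !W_circE ?mxE; ring.
rewrite -[RHS]/(a *: W_circ x u + W_circ x v).
by apply: rV4P; rewrite !mxE !W_circE ?mxE; ring.
Qed.

Lemma nu_bilinear : is_bilinear (@nu K : W -> W -> K^o).
Proof.
split=> [y|x] a u v.
  by rewrite -[RHS]/(a * nu u y + nu v y) !nuE !mxE; ring.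
by rewrite -[RHS]/(a * nu x u + nu x v) !nuE !mxE; ring.
Qed.

Lemma W_leibniz (x y z : W) :
  W_circ x (W_circ y z) = W_circ (W_circ x y) z + W_circ y (W_circ x z).
Proof. by apply: rV4P; rewrite !mxE !W_circE; ring. Qed.

Lemma nu_skew (x y : W) : nu x y = - nu y x.
Proof. by rewrite !nuE; ring. Qed.

Lemma nu_invariant (x y z : W) :
  nu (W_circ x y) z = nu x (W_circ y z + W_circ z y).
Proof. by rewrite !nuE !mxE !W_circE; ring. Qed.

Lemma nu_nondegenerate (x : W) : (forall y, nu x y = 0) -> x = 0.
Proof.
move=> x0; apply: rV4P; rewrite [RHS]mxE.
(* Up to sign, the vectors with indices 3, 4, 1, 2 are dual under [nu] to those with indices 1, 2,
   3, 4. *)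
- by rewrite -(x0 (eps K 3)) nuE !mxE /=; ring.
- by rewrite -(x0 (eps K 4)) nuE !mxE /=; ring.
- by apply/eqP; rewrite -oppr_eq0 -(x0 (eps K 1)) nuE !mxE /=; apply/eqP; ring.
- by apply/eqP; rewrite -oppr_eq0 -(x0 (eps K 2)) nuE !mxE /=; apply/eqP; ring.
Qed.

Local Notation circ := (@WL_circ K).
Local Notation phi := (@WL_form K).

Lemma dinj_deg m n (x : W) : m = n -> @dinj K (WL K) m x = @dinj K (WL K) n x.
Proof. by move=> ->. Qed.

Lemma dinj_add m (x y : W) : @dinj K (WL K) m (x + y) =
  @dinj K (WL K) m x + @dinj K (WL K) m y.
Proof. exact: (linD (@dinj_linear K (WL K) m)). Qed.

Let Gcirc m n (x y : W) : dsum (WL K) := @dinj K (WL K) (m + n) (W_circ x y).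
Let Gform (m n : int) (x y : W) : K^o := nu x y * (m + n == 0)%:R.

Let Gcirc_bilinear m n : is_bilinear (Gcirc m n).
Proof.
split=> [y|x] a u v; rewrite /Gcirc -dinj_linear; congr dinj.
  exact: W_circ_bilinear.1.
exact: W_circ_bilinear.2.
Qed.

Let Gform_bilinear m n : is_bilinear (Gform m n).
Proof.
split=> [y|x] a u v; rewrite /Gform.
  by rewrite [nu _ _](nu_bilinear.1 y a u v) mulrDl -mulrA.
by rewrite [nu _ _](nu_bilinear.2 x a u v) mulrDl -mulrA.
Qed.

Lemma WL_circ_bilinear : is_bilinear circ.
Proof. exact: (dsum_bil_bilinear Gcirc_bilinear). Qed.

Lemma WL_form_bilinear : is_bilinear phi.
Proof. exact: (dsum_bil_bilinear Gform_bilinear). Qed.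

Lemma WL_circ_dinj m n (x y : W) :
  circ (@dinj K (WL K) m x) (@dinj K (WL K) n y) =
    @dinj K (WL K) (m + n) (W_circ x y).
Proof. exact: (@dsum_bil_dinj K (WL K) (WL K) _ _ Gcirc_bilinear m x n y). Qed.

Lemma WL_form_dinj m n (x y : W) :
  phi (@dinj K (WL K) m x) (@dinj K (WL K) n y) = nu x y * (m + n == 0)%:R.
Proof. exact: (@dsum_bil_dinj K (WL K) (WL K) _ _ Gform_bilinear m x n y). Qed.

(** Each identity is multilinear, hence checked on homogeneous elements, where it is the identity of
    [W] with degrees added. *)
Lemma WL_quadratic : quadratic_graded_leibniz circ phi.
Proof.
have [cl cr] := WL_circ_bilinear; have [fl fr] := WL_form_bilinear.
have zL : linear (fun _ : dsum (WL K) => 0 : K^o).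
  by move=> c u v; rewrite scaler0 addr0.
split=> [|i j x y|x y z||x x0|x y|x y z|].
- exact: WL_circ_bilinear.
- by exists (W_circ x y); rewrite WL_circ_dinj.
- move: x; apply: (@dsum_eq _ (WL K)) => [||i x].
  + exact: (cl (circ y z)).
  + move=> c u v; rewrite [circ (c *: u + v) y](cl y) [circ (c *: u + v) z](cl z).
    by rewrite [circ (_ + _) z](cl z) (cr y) scalerDr addrACA.
  move: y; apply: (@dsum_eq _ (WL K)) => [||j y].
  + exact: (lin_comp (cr (dinj x)) (cl z)).
  + move=> c u v; rewrite [circ (dinj x) _](cr (dinj x)) [circ (_ + _) z](cl z).
    by rewrite [circ (c *: u + v) _](cl (circ (dinj x) z)) scalerDr addrACA.
  move: z; apply: (@dsum_eq _ (WL K)) => [||k z].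
  + exact: (lin_comp (cr (dinj x)) (cr (dinj y))).
  + move=> c u v; rewrite [circ (circ _ _) _](cr (circ (dinj x) (dinj y))).
    by rewrite [circ (dinj x) (_ + _)](cr (dinj x)) (cr (dinj y)) scalerDr addrACA.
  rewrite !WL_circ_dinj W_leibniz -[i + j + k]addrA.
  by rewrite (@dinj_deg (j + (i + k)) (i + (j + k))) 1?addrCA // dinj_add.
- exact: WL_form_bilinear.
(* Pairing with [y] placed in degree [- i] isolates the component of degree [i]. *)
- apply: dsum_ext => i; apply: nu_nondegenerate => y.
  rewrite -[RHS](x0 (@dinj K (WL K) (- i) y)) -[LHS]mulr1.
  rewrite -[X in _ = X]/(phi x _).
  have -> : phi x (@dinj K (WL K) (- i) y) =
      \sum_(j \in [set: int]%classic) Gform j (- i) (x j) y.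
    apply: eq_fsbigr => j _; apply: (etrans (fsum1 (x0 := - i) _)).
      move=> k ki; rewrite [X in nu _ X]dinj_out //.
      exact: (lin0 ((Gform_bilinear j k).2 _)).
    by rewrite [X in nu _ X]dinj_same.
  rewrite (fsum1 (x0 := i)) /Gform ?subrr // => j ji.
  by rewrite subr_eq0 (negPf ji) mulr0.
- move: x; apply: (@dsum_eq _ (WL K) K^o) => [||i x].
  + exact: fl.
  + by move=> c u v; rewrite (fr y) opprD scalerN.
  move: y; apply: (@dsum_eq _ (WL K) K^o) => [||j y].
  + exact: fr.
  + by move=> c u v; rewrite (fl (dinj x)) opprD scalerN.
  by rewrite !WL_form_dinj nu_skew mulNr addrC.
- move: x; apply: (@dsum_eq _ (WL K) K^o) => [||i x].
  + exact: (lin_comp (fl z) (cl y)).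
  + exact: fl.
  move: y; apply: (@dsum_eq _ (WL K) K^o) => [||j y].
  + exact: (lin_comp (fl z) (cr (dinj x))).
  + move=> c u v; rewrite (cl z) (cr z) addrACA -scalerDr; exact: fr.
  move: z; apply: (@dsum_eq _ (WL K) K^o) => [||k z].
  + exact: fr.
  + by move=> c u v; rewrite (cr (dinj y)) (cl (dinj y)) addrACA -scalerDr;
    exact: fr.
  rewrite !WL_circ_dinj (@dinj_deg (k + j) (j + k)) 1?[k + j]addrC //.
  by rewrite -dinj_add !WL_form_dinj nu_invariant addrA.
exists 0 => i j x y ij; rewrite WL_form_dinj; move: ij; rewrite addr0 => /negPf ->.
by rewrite mulr0.
Qed.

Let e n : dsum (WL K) := @dinj K (WL K) 0 (eps K n).

Lemma WL_word (x y z t : W) :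
  word circ phi (@dinj K (WL K) 0 x) (@dinj K (WL K) 0 y) (@dinj K (WL K) 0 z)
    (@dinj K (WL K) 0 t) = nu x (W_circ y (W_circ z t)).
Proof. by rewrite /word !WL_circ_dinj WL_form_dinj mulr1. Qed.

(* With first letter eps_2, the word in the order eps_3, eps_2, eps_1 is 1 and
   the five other orders give 0. *)
Lemma WL_words_free : words_free circ phi.
Proof.
move=> c1 c2 c3 c4 c5 c6 c0.
have {}c0 x y z := c0 0 0 0 0 (eps K 2) (eps K x) (eps K y) (eps K z).
split; split.
(* For each coefficient the letters are assigned so that the corresponding order spells eps_3,
   eps_2, eps_1. *)
- by have := c0 3 2 1; rewrite /sum6 !WL_word !nuE !W_circE !mxE /= => <-; ring.
- by have := c0 3 1 2; rewrite /sum6 !WL_word !nuE !W_circE !mxE /= => <-; ring.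
- by have := c0 2 3 1; rewrite /sum6 !WL_word !nuE !W_circE !mxE /= => <-; ring.
- by have := c0 1 3 2; rewrite /sum6 !WL_word !nuE !W_circE !mxE /= => <-; ring.
- by have := c0 2 1 3; rewrite /sum6 !WL_word !nuE !W_circE !mxE /= => <-; ring.
- by have := c0 1 2 3; rewrite /sum6 !WL_word !nuE !W_circE !mxE /= => <-; ring.
Qed.

End LaurentAlgebra.

(** * The copairing combined with the two implications *)

Theorem theorem3p21 (K : fieldType) :
  (forall (P : vectType K) (rhd lhd : P -> P -> P) (brhd blhd : P -> tens P P)
          (Q : grading K) (circ : dsum Q -> dsum Q -> dsum Q)
          (varpi : dsum Q -> dsum Q -> K^o),
     zinbiel_dendriform_bialgebra rhd lhd brhd blhd ->
     quadratic_graded_leibniz circ varpi ->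
     exists theta : dsum Q -> ctens Q Q,
       unique (is_vartheta circ varpi) theta /\
       completed_pre_lie_bialgebra
         (PQ_dot rhd lhd circ) (PQ_delta brhd blhd theta))
  /\
  (quadratic_graded_leibniz (@WL_circ K) (@WL_form K) /\
   forall (P : vectType K) (rhd lhd : P -> P -> P) (brhd blhd : P -> tens P P),
     is_bilinear rhd -> is_bilinear lhd -> linear brhd -> linear blhd ->
     exists theta : dsum (WL K) -> ctens (WL K) (WL K),
       unique (is_vartheta (@WL_circ K) (@WL_form K)) theta /\
       (completed_pre_lie_bialgebra
          (PQ_dot rhd lhd (@WL_circ K)) (PQ_delta brhd blhd theta)
        <-> zinbiel_dendriform_bialgebra rhd lhd brhd blhd)).
Proof.
split=> [P rhd lhd brhd blhd Q circ varpi zP qQ|].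
  have [m mdeg] := qgl_form_graded qQ.
  exists (vartheta qQ mdeg); split; first exact: unique_vartheta.
  (* Here bilinearity of the operations and linearity of the cooperations are read off the bialgebra
     axioms; for the Laurent algebra they are hypotheses. *)
  case: (zP) => -[rB lB _ _ _] [brL blL _ _ _ _] _ _ _ _ _ _.
  apply: (completed_pre_lie_of_zinbiel_dendriform qQ mdeg) => //.
  exact: is_vartheta_vartheta.
split=> [|P rhd lhd brhd blhd rB lB brL blL]; first exact: WL_quadratic.
have [m mdeg] := qgl_form_graded (WL_quadratic K).
exists (vartheta (WL_quadratic K) mdeg); split; first exact: unique_vartheta.
have thP := is_vartheta_vartheta (WL_quadratic K) mdeg.
split; last exact: (completed_pre_lie_of_zinbiel_dendriform (WL_quadratic K) mdeg).
apply: (zinbiel_dendriform_of_completed_pre_lie (WL_quadratic K) mdeg) => //.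
exact: WL_words_free.
Qed.
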